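(* Let $a=\tfrac14$, $d\neq\tfrac14$ and $b=e\neq0$. Then $\mathcal L=\mathcal L_{a,b,d,e}$ is a real Lie algebra of dimension $6$ with basis (where $\exp$ is the exponential function) \begin{align*} v_1&=b\exp(bt)x\,\partial_x+b\exp(bt)y\,\partial_y+\exp(bt)\partial_t+2b\exp(bt)\big(b(x+y)-(\tfrac14+d)\big)u\,\partial_u,\\ v_2&=-b\exp(-bt)x\,\partial_x-b\exp(-bt)y\,\partial_y+\exp(-bt)\partial_t,\qquad v_3=\partial_t-b(\tfrac14+d)u\,\partial_u,\\ v_4&=\sqrt x\exp(\tfrac b2t)\partial_x+2b\sqrt x\exp(\tfrac b2t)u\,\partial_u,\qquad v_5=\sqrt x\exp(-\tfrac b2t)\partial_x,\qquad v_6=u\,\partial_u . \end{align*} The linear map $\mathcal L\to\mathcal M$ given by $$v_1\mapsto E,\quad v_2\mapsto-b^2F,\quad v_3\mapsto\tfrac b2H,\quad v_4\mapsto X,\quad v_5\mapsto-bY,\quad v_6\mapsto Z$$ is a morphism of Lie algebras. Therefore $\mathcal L$ is isomorphic to $\mathcal M$, hence to $\mathcal H_{0,0}$.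
   Context: All Lie algebras are real. For real constants $a,b,d,e$ consider the PDE $$\Delta:=(a-bx)u_x+(d-ey)u_y+\tfrac x2u_{xx}+\tfrac y2u_{yy}+u_t=0$$ for $u=u(x,y,t)$, $x,y>0$, $t\in\mathbb R$. An infinitesimal symmetry of the PDE is a smooth vector field $v=\xi\partial_x+\gamma\partial_y+\tau\partial_t+\phi\partial_u$ on $\{(x,y,t,u):x>0,y>0,t\in\mathbb R,u\in\mathbb R\}$, with $\xi,\gamma,\tau,\phi$ functions of $(x,y,t,u)$, whose second prolongation $\mathrm{pr}^{(2)}v$ satisfies $\mathrm{pr}^{(2)}v(\Delta)=0$ at all points of the second jet space where $\Delta=0$. $\mathcal V_{a,b,d,e}$ is the Lie algebra of all infinitesimal symmetries, under the Lie bracket of vector fields. For every $v\in\mathcal V_{a,b,d,e}$ the coefficient $\phi$ is affine in $u$: $\phi=\lambda_v(x,y,t)u+\mu_v(x,y,t)$. Set $\mathcal L_{a,b,d,e}=\{v\in\mathcal V_{a,b,d,e}:\mu_v=0\}$. $\mathcal M$ is the 6-dimensional real Lie algebra with basis $E,F,H,X,Y,Z$ and nonzero brackets (up to antisymmetry) $[E,F]=H$, $[H,E]=2E$, $[H,F]=-2F$, $[X,Y]=Z$, $[E,Y]=X$, $[F,X]=Y$, $[H,X]=X$, $[H,Y]=-Y$; thus $\mathcal M\cong\mathfrak{sl}_2\ltimes\mathfrak h_3$ with $\mathfrak h_3=\langle X,Y,Z\rangle$ the Heisenberg algebra. $\mathcal H_{0,0}$ is the 6-dimensional Lie symmetry algebra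 of the heat equation $\frac{\partial u}{\partial t}=-\frac{\partial^2u}{\partial q^2}$ for $u=u(t,q)$ (the symmetries coming from linear superposition of solutions being left out).
   Formalization: The case d = 3/4 is excluded: there the vector field √y exp(-bt/2)∂_y - (1/(2√y)) exp(-bt/2) u∂_u is a further element of L outside the span of v_1,…,v_6, so dimension 6 and the basis claim fail. *)

(* Defs.v *)
From Stdlib Require Import Reals List FinFun ClassicalEpsilon FunctionalExtensionality.
From Coquelicot Require Import Coquelicot.
Import ListNotations.

Open Scope R_scope.

Section FunctionSpace.
Context (T : Type) (V : ModuleSpace R_AbsRing).

Definition fct_AbelianMonoid_mixin : AbelianMonoid.mixin_of (T -> V).
Proof.
refine (AbelianMonoid.Mixin (T -> V)
  (fun f g t => plus (f t) (g t)) (fun _ => zero) _ _ _); intros;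
  apply functional_extensionality; intros t;
  [apply plus_comm | apply plus_assoc | apply plus_zero_r].
Defined.

Canonical fct_AbelianMonoid :=
  AbelianMonoid.Pack (T -> V) fct_AbelianMonoid_mixin (T -> V).

Definition fct_AbelianGroup_mixin : AbelianGroup.mixin_of fct_AbelianMonoid.
Proof.
refine (AbelianGroup.Mixin fct_AbelianMonoid (fun f t => opp (f t)) _); intros;
  apply functional_extensionality; intros t; apply (plus_opp_r (x t)).
Defined.

Canonical fct_AbelianGroup := AbelianGroup.Pack (T -> V)
  (AbelianGroup.Class _ fct_AbelianMonoid_mixin fct_AbelianGroup_mixin) (T -> V).

Definition fct_ModuleSpace_mixin :
  ModuleSpace.mixin_of R_AbsRing fct_AbelianGroup.
Proof.
refine (ModuleSpace.Mixin R_AbsRing fct_AbelianGroup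
  (fun k f t => scal k (f t)) _ _ _ _); intros;
  apply functional_extensionality; intros t;
  [apply scal_assoc | apply scal_one | apply @scal_distr_l | apply @scal_distr_r].
Defined.

Canonical fct_ModuleSpace := ModuleSpace.Pack R_AbsRing (T -> V)
  (ModuleSpace.Class _ _ _ fct_ModuleSpace_mixin) (T -> V).
End FunctionSpace.

(** A subset [lie_car] of a real vector space on which a binary operation is
    given.  The ambient operation is arbitrary: [is_lie_algebra] asks for the
    axioms on [lie_car] only. *)
Record lie_data := LieData {
  lie_amb :> ModuleSpace R_AbsRing;
  lie_car : lie_amb -> Prop;
  lie_brk : lie_amb -> lie_amb -> lie_amb }.

Arguments lie_brk {_} _ _.

Record is_lie_algebra (g : lie_data) : Prop := {
  lie_zero : lie_car g zero;
  lie_plus : forall v w, lie_car g v -> lie_car g w -> lie_car g (plus v w);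
  lie_scal : forall (k : R) v, lie_car g v -> lie_car g (scal k v);
  lie_closed : forall v w, lie_car g v -> lie_car g w -> lie_car g (lie_brk v w);
  lie_linear_l : forall (k : R) v v' w,
    lie_car g v -> lie_car g v' -> lie_car g w ->
    lie_brk (plus (scal k v) v') w = plus (scal k (lie_brk v w)) (lie_brk v' w);
  lie_linear_r : forall (k : R) v w w',
    lie_car g v -> lie_car g w -> lie_car g w' ->
    lie_brk v (plus (scal k w) w') = plus (scal k (lie_brk v w)) (lie_brk v w');
  lie_alternating : forall v, lie_car g v -> lie_brk v v = zero;
  lie_jacobi : forall u v w, lie_car g u -> lie_car g v -> lie_car g w ->
    plus (lie_brk u (lie_brk v w))
      (plus (lie_brk v (lie_brk w u)) (lie_brk w (lie_brk u v))) = zero }.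

Fixpoint lincomb {V : ModuleSpace R_AbsRing} (c : list R) (l : list V) : V :=
  match c, l with
  | k :: c', v :: l' => plus (scal k v) (lincomb c' l')
  | _, _ => zero
  end.

Definition is_basis (g : lie_data) (l : list g) : Prop :=
  (forall v, In v l -> lie_car g v) /\
  forall v, lie_car g v ->
    exists! c : list R, length c = length l /\ lincomb c l = v.

Definition has_dimension (g : lie_data) (n : nat) : Prop :=
  exists l : list g, is_basis g l /\ length l = n.

Definition is_linear_map (g h : lie_data) (f : g -> h) : Prop :=
  (forall v, lie_car g v -> lie_car h (f v)) /\
  (forall (k : R) v w, lie_car g v -> lie_car g w ->
    f (plus (scal k v) w) = plus (scal k (f v)) (f w)).

Definition is_lie_morphism (g h : lie_data) (f : g -> h) : Prop :=
  is_linear_map g h f /\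
  forall v w, lie_car g v -> lie_car g w ->
    f (lie_brk v w) = lie_brk (f v) (f w).

Definition lie_isomorphic (g h : lie_data) : Prop :=
  exists f : g -> h, is_lie_morphism g h f /\
    (forall v w, lie_car g v -> lie_car g w -> f v = f w -> v = w) /\
    (forall w, lie_car h w -> exists v, lie_car g v /\ f v = w).

Class Index (I : Type) := {
  index_dec : forall i j : I, {i = j} + {i <> j};
  index_enum : list I;
  index_listing : Listing index_enum }.

Definition isum {I} `{Index I} (F : I -> R) : R :=
  fold_right Rplus 0 (map F index_enum).

Definition upd {I} `{Index I} (z : I -> R) (i : I) (s : R) : I -> R :=
  fun j => if index_dec j i then s else z j.

#[export] Instance index_option (I : Type) `{Index I} : Index (option I).
Proof.
refine {| index_enum := None :: map Some index_enum |}.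
- decide equality; apply index_dec.
- destruct index_listing as [nd full]; split.
  + constructor.
    * intros h; apply in_map_iff in h; destruct h as [i [e _]]; discriminate.
    * apply Injective_map_NoDup; [intros i j e; congruence | exact nd].
  + intros [i |]; [right; apply in_map, full | left; reflexivity].
Defined.

Section VectorFields.
Context {J : Type} `{Index J}.

Definition pd (j : J) (f : (J -> R) -> R) (z : J -> R) : R :=
  Derive (fun s => f (upd z j s)) (z j).

Definition ex_pd (j : J) (f : (J -> R) -> R) (z : J -> R) : Prop :=
  ex_derive (fun s => f (upd z j s)) (z j).

(** [continuous] refers to the uniform structure of [J -> R], which for the
    finite [J] considered here is the product topology.  [D] is meant to be
    open, so that [pd] on [D] does not see the values of [f] outside [D]. *)
Fixpoint class_C (n : nat) (D : (J -> R) -> Prop) (f : (J -> R) -> R) : Prop :=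
  (forall z, D z -> continuous f z) /\
  match n with
  | O => True
  | S m => forall j, (forall z, D z -> ex_pd j f z) /\ class_C m D (pd j f)
  end.

Definition vfield : ModuleSpace R_AbsRing :=
  fct_ModuleSpace (J -> R) (fct_ModuleSpace J (AbsRing_ModuleSpace R_AbsRing)).

(** A vector field on [D] is represented by its extension by zero to the whole
    space, so that equality of functions is equality of vector fields on [D]. *)
Definition smooth_vfield (D : (J -> R) -> Prop) (v : vfield) : Prop :=
  (forall j n, class_C n D (fun z => v z j)) /\
  (forall z j, ~ D z -> v z j = 0).

Definition ext0 (D : (J -> R) -> Prop) (v : vfield) : vfield :=
  fun z j => if excluded_middle_informative (D z) then v z j else 0.

Definition vbracket (v w : vfield) : vfield := fun z k =>
  isum (fun j => v z j * pd j (fun z' => w z' k) z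
               - w z j * pd j (fun z' => v z' k) z).
End VectorFields.

Arguments vfield J : clear implicits.

(** [I] indexes the independent variables.  The space of independent and
    dependent variables is [option I -> R], with [u] the coordinate [None].  A
    point of the second jet space is a triple [z], [p], [q] with
    [p i] = u_i and [q i j] = u_ij, where [q] is symmetric. *)
Section Symmetries.
Context {I : Type} `{Index I}.

Definition jet_function := (option I -> R) -> (I -> R) -> (I -> I -> R) -> R.

Definition total_derivative0 (i : I) (f : (option I -> R) -> R)
  (z : option I -> R) (p : I -> R) : R :=
  pd (Some i) f z + p i * pd None f z.

Definition total_derivative1 (i : I) (f : (option I -> R) -> (I -> R) -> R)
  (z : option I -> R) (p : I -> R) (q : I -> I -> R) : R :=
  pd (Some i) (fun z' => f z' p) z + p i * pd None (fun z' => f z' p) z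
  + isum (fun k => q i k * pd k (fun p' => f z p') p).

(** Olver's prolongation formulas: phi^i = D_i phi - sum_k u_k D_i xi^k *)
Definition prolong1 (v : vfield (option I)) (i : I)
  (z : option I -> R) (p : I -> R) : R :=
  total_derivative0 i (fun z' => v z' None) z p
  - isum (fun k => p k * total_derivative0 i (fun z' => v z' (Some k)) z p).

(** phi^ij = D_j phi^i - sum_k u_ik D_j xi^k *)
Definition prolong2 (v : vfield (option I)) (i j : I)
  (z : option I -> R) (p : I -> R) (q : I -> I -> R) : R :=
  total_derivative1 j (prolong1 v i) z p q
  - isum (fun k => q i k * total_derivative0 j (fun z' => v z' (Some k)) z p).

(** pr^(2) v (Delta): the derivative of [Delta] along the vector field
    pr^(2) v of the jet space. *)
Definition pr2 (v : vfield (option I)) (Delta : jet_function) : jet_function :=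
  fun z p q =>
    Derive (fun s => Delta (fun k => z k + s * v z k)
                           (fun i => p i + s * prolong1 v i z p)
                           (fun i j => q i j + s * prolong2 v i j z p q)) 0.

Definition is_symmetry (D : (option I -> R) -> Prop) (Delta : jet_function)
  (v : vfield (option I)) : Prop :=
  smooth_vfield D v /\
  forall z p q, D z -> (forall i j, q i j = q j i) ->
    Delta z p q = 0 -> pr2 v Delta z p q = 0.

Definition indep (z : option I -> R) : I -> R := fun i => z (Some i).

(** The symmetries whose [u]-coefficient is lambda u + mu with mu = 0, that is,
    without the superposition symmetries of a linear PDE. *)
Definition is_linear_symmetry (D : (option I -> R) -> Prop)
  (Delta : jet_function) (v : vfield (option I)) : Prop :=
  is_symmetry D Delta v /\
  exists lambda mu : (I -> R) -> R,
    (forall z, D z ->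
      v z None = lambda (indep z) * z None + mu (indep z)) /\
    (forall z, D z -> mu (indep z) = 0).

Definition symmetry_algebra (D : (option I -> R) -> Prop)
  (Delta : jet_function) : lie_data :=
  LieData (vfield (option I)) (is_linear_symmetry D Delta) vbracket.
End Symmetries.

Inductive xyt := x_ | y_ | t_.

#[export] Instance index_xyt : Index xyt.
Proof.
refine {| index_enum := [x_; y_; t_] |}.
- decide equality.
- split; [repeat constructor; simpl; intuition discriminate
         | intros []; simpl; tauto].
Defined.

Definition quadrant (z : option xyt -> R) : Prop :=
  0 < z (Some x_) /\ 0 < z (Some y_).

Definition Delta_two_factor (a b d e : R) : jet_function (I := xyt) :=
  fun z p q =>
    let x := z (Some x_) in let y := z (Some y_) in
    (a - b * x) * p x_ + (d - e * y) * p y_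
    + x / 2 * q x_ x_ + y / 2 * q y_ y_ + p t_.

Definition L_alg (a b d e : R) : lie_data :=
  symmetry_algebra quadrant (Delta_two_factor a b d e).

Definition vf_xytu (xi gamma tau phi : R -> R -> R -> R -> R) :
  vfield (option xyt) :=
  ext0 quadrant (fun z k =>
    let at_z (f : R -> R -> R -> R -> R) :=
      f (z (Some x_)) (z (Some y_)) (z (Some t_)) (z None) in
    match k with
    | Some x_ => at_z xi
    | Some y_ => at_z gamma
    | Some t_ => at_z tau
    | None => at_z phi
    end).

Definition v1 (b d : R) : vfield (option xyt) := vf_xytu
  (fun x y t u => b * exp (b * t) * x)
  (fun x y t u => b * exp (b * t) * y)
  (fun x y t u => exp (b * t))
  (fun x y t u => 2 * b * exp (b * t) * (b * (x + y) - (1 / 4 + d)) * u).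

Definition v2 (b : R) : vfield (option xyt) := vf_xytu
  (fun x y t u => - b * exp (- b * t) * x)
  (fun x y t u => - b * exp (- b * t) * y)
  (fun x y t u => exp (- b * t))
  (fun x y t u => 0).

Definition v3 (b d : R) : vfield (option xyt) := vf_xytu
  (fun x y t u => 0)
  (fun x y t u => 0)
  (fun x y t u => 1)
  (fun x y t u => - b * (1 / 4 + d) * u).

Definition v4 (b : R) : vfield (option xyt) := vf_xytu
  (fun x y t u => sqrt x * exp (b / 2 * t))
  (fun x y t u => 0)
  (fun x y t u => 0)
  (fun x y t u => 2 * b * sqrt x * exp (b / 2 * t) * u).

Definition v5 (b : R) : vfield (option xyt) := vf_xytu
  (fun x y t u => sqrt x * exp (- b / 2 * t))
  (fun x y t u => 0)
  (fun x y t u => 0)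
  (fun x y t u => 0).

Definition v6 : vfield (option xyt) := vf_xytu
  (fun x y t u => 0)
  (fun x y t u => 0)
  (fun x y t u => 0)
  (fun x y t u => u).

Inductive M_index := M_E | M_F | M_H | M_X | M_Y | M_Z.

#[export] Instance index_M : Index M_index.
Proof.
refine {| index_enum := [M_E; M_F; M_H; M_X; M_Y; M_Z] |}.
- decide equality.
- split; [repeat constructor; simpl; intuition discriminate
         | intros []; simpl; tauto].
Defined.

Definition M_space : ModuleSpace R_AbsRing :=
  fct_ModuleSpace M_index (AbsRing_ModuleSpace R_AbsRing).

Definition M_vec (i : M_index) : M_space :=
  fun k => if index_dec i k then 1 else 0.

Definition M_table (i j : M_index) : M_space :=
  match i, j with
  | M_E, M_F => M_vec M_H                | M_F, M_E => opp (M_vec M_H)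
  | M_H, M_E => scal 2 (M_vec M_E)       | M_E, M_H => scal (-2) (M_vec M_E)
  | M_H, M_F => scal (-2) (M_vec M_F)    | M_F, M_H => scal 2 (M_vec M_F)
  | M_X, M_Y => M_vec M_Z                | M_Y, M_X => opp (M_vec M_Z)
  | M_E, M_Y => M_vec M_X                | M_Y, M_E => opp (M_vec M_X)
  | M_F, M_X => M_vec M_Y                | M_X, M_F => opp (M_vec M_Y)
  | M_H, M_X => M_vec M_X                | M_X, M_H => opp (M_vec M_X)
  | M_H, M_Y => opp (M_vec M_Y)          | M_Y, M_H => M_vec M_Y
  | _, _ => zero
  end.

Definition M_bracket (A B : M_space) : M_space :=
  fun k => isum (fun i => isum (fun j => A i * B j * M_table i j k)).

Definition M_alg : lie_data := LieData M_space (fun _ => True) M_bracket.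

Inductive tq := th_ | qh_.

#[export] Instance index_tq : Index tq.
Proof.
refine {| index_enum := [th_; qh_] |}.
- decide equality.
- split; [repeat constructor; simpl; intuition discriminate
         | intros []; simpl; tauto].
Defined.

Definition Delta_heat : jet_function (I := tq) :=
  fun z p q => p th_ + q qh_ qh_.

(** The superposition symmetries are left out by [is_linear_symmetry]. *)
Definition H00_alg : lie_data := symmetry_algebra (fun _ => True) Delta_heat.

(* Main.v *)
Require Import Defs.
From Stdlib Require Import Reals List.
From Coquelicot Require Import Coquelicot.
From Stdlib Require Import Lra ClassicalEpsilon FunctionalExtensionality.
Import ListNotations.

Open Scope R_scope.

(** The six-parameter families [heat_field] and [two_factor_field] embed M
    linearly and compatibly with brackets into the two symmetry algebras, so what
    remains is to see that every symmetry belongs to its family.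

    For the two-factor equation the coefficients of u_xt, u_yt, u_xy, u_xx, u_yy in
    pr^(2) v (Delta) give tau = tau(t) and, after integration,
    xi = x tau' + sqrt x (alpha - kappa sqrt y),
    gamma = y tau' + sqrt y (beta + kappa sqrt x), where alpha, beta and the
    rotation part kappa depend on t only.  The coefficients of u_x and u_y then
    express lambda_x and lambda_y, and their compatibility says kappa' = 0.
    Finally lambda solves the equation itself; its term in y^(-3/2) is
    (d - 1/4) (2 d - 3/2) (beta + kappa sqrt x) / 4, so beta = kappa = 0 when d is
    neither 1/4 nor 3/4, and the other terms are tau''' = b^2 tau',
    alpha'' = (b/2)^2 alpha and a first order equation for the part of lambda that
    depends on t only.  The heat equation is similar, with tau''' = alpha'' = 0. *)

(** * Lie algebras isomorphic to M *)

(** In r = sqrt x, s = sqrt y, and apart from the linear drifts, a = 1/4 makes the x-part the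
    constant coefficient operator u_rr / 8, whereas the y-part is u_ss / 8 + (d - 1/4) u_s / (2 s).
    A gauge factor trades the last term for the potential -(d - 1/4) (d - 3/4) / (2 s^2). Thus alpha
    and beta are the translations and kappa the rotation of the (r, s)-plane, and the inverse square
    potential rules out beta and kappa unless it vanishes: this is the origin of both excluded
    values of d.

    A direct proof that symmetries are closed under brackets would need the prolongation of a
    bracket. It is avoided: closure, Jacobi, dimension and basis all come from M once the family is
    known to be everything.

    Members of the families are reified formulas, differentiated by [deriv]. An unknown symmetry is
    only known to be smooth, so its determining equations are obtained by evaluating the symmetry
    condition at finitely many numerical jets and eliminating with [lra]. *)

Lemma M_bracketE (A B : M_space) : M_bracket A B = fun k =>
  match k with
  | M_E => 2 * (A M_H * B M_E - A M_E * B M_H)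
  | M_F => - 2 * (A M_H * B M_F - A M_F * B M_H)
  | M_H => A M_E * B M_F - A M_F * B M_E
  | M_X => A M_E * B M_Y - A M_Y * B M_E + (A M_H * B M_X - A M_X * B M_H)
  | M_Y => A M_F * B M_X - A M_X * B M_F - (A M_H * B M_Y - A M_Y * B M_H)
  | M_Z => A M_X * B M_Y - A M_Y * B M_X
  end.
Proof.
apply functional_extensionality; intros k; unfold M_bracket, isum, M_vec.
destruct k; cbn; unfold mult; simpl; ring.
Qed.

Ltac M_ext := let i := fresh "i" in
  apply functional_extensionality; intros i; destruct i; cbn;
  unfold mult; simpl; ring.

Lemma M_lie_algebra : is_lie_algebra M_alg.
Proof.
split; cbn [lie_car lie_brk M_alg]; try (intros; exact I); intros;
  change (fct_ModuleSpace M_index (AbsRing_ModuleSpace R_AbsRing)) with M_space in *;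
  rewrite ?M_bracketE; M_ext.
Qed.

(** The equivalence [model_car] holds both halves of a classification: every member of the family is
    a symmetry, and every symmetry is a member. The target [h] is not assumed to be a Lie algebra;
    that is a consequence. *)
Record lie_model (g h : lie_data) (F : g -> h) : Prop := {
  model_linear : forall (k : R) v w, lie_car g v -> lie_car g w ->
    F (plus (scal k v) w) = plus (scal k (F v)) (F w);
  model_inj : forall v w, lie_car g v -> lie_car g w -> F v = F w -> v = w;
  model_car : forall w, lie_car h w <-> exists v, lie_car g v /\ F v = w;
  model_brk : forall v w, lie_car g v -> lie_car g w ->
    lie_brk (F v) (F w) = F (lie_brk v w) }.

Section Model.
Context {g h : lie_data} {F : g -> h} (m : lie_model g h F) (lg : is_lie_algebra g).

Lemma model_in v : lie_car g v -> lie_car h (F v).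
Proof. intros hv; apply (model_car _ _ _ m); now exists v. Qed.

Lemma model_zero : F zero = zero.
Proof.
pose proof (lie_zero _ lg) as h0.
(* Linearity is given only for combinations k v + w; with k = -1 it reads F 0 = - F 0 + F 0. *)
pose proof (model_linear _ _ _ m (-1) zero zero h0 h0) as e.
rewrite scal_zero_r, plus_zero_l in e; rewrite e at 1.
rewrite (@scal_opp_one R_AbsRing h (F zero) : scal (-1) _ = _).
apply (@plus_opp_l h).
Qed.

Lemma model_scal (k : R) v : lie_car g v -> F (scal k v) = scal k (F v).
Proof.
intros hv; pose proof (model_linear _ _ _ m k v zero hv (lie_zero _ lg)) as e.
now rewrite model_zero, !plus_zero_r in e.
Qed.

Lemma model_plus v w : lie_car g v -> lie_car g w -> F (plus v w) = plus (F v) (F w).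
Proof.
intros hv hw; pose proof (model_linear _ _ _ m 1 v w hv hw) as e.
change 1 with (one : R_AbsRing) in e; now rewrite !(@scal_one R_AbsRing) in e.
Qed.

(** Each axiom is pulled back to [g] by choosing preimages; closure of [lie_car h] under its bracket
    is obtained in the same way. *)
Lemma model_lie_algebra : is_lie_algebra h.
Proof.
destruct lg as [l0 lp ls lc ll lr la lj].
split.
- rewrite <- model_zero; now apply model_in.
- intros v w hv hw; apply (model_car _ _ _ m) in hv, hw.
  destruct hv as [v' [hv <-]], hw as [w' [hw <-]].
  rewrite <- model_plus by trivial; now apply model_in, lp.
- intros k v hv; apply (model_car _ _ _ m) in hv; destruct hv as [v' [hv <-]].
  rewrite <- model_scal by trivial; now apply model_in, ls.
- intros v w hv hw; apply (model_car _ _ _ m) in hv, hw.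
  destruct hv as [v' [hv <-]], hw as [w' [hw <-]].
  rewrite (model_brk _ _ _ m) by trivial; now apply model_in, lc.
- intros k v v' w hv hv' hw; apply (model_car _ _ _ m) in hv, hv', hw.
  destruct hv as [x [hv <-]], hv' as [y [hv' <-]], hw as [z [hw <-]].
  rewrite <- (model_linear _ _ _ m), !(model_brk _ _ _ m), ll by auto.
  rewrite (model_linear _ _ _ m); auto.
- intros k w v v' hw hv hv'; apply (model_car _ _ _ m) in hv, hv', hw.
  destruct hv as [x [hv <-]], hv' as [y [hv' <-]], hw as [z [hw <-]].
  rewrite <- (model_linear _ _ _ m), !(model_brk _ _ _ m), lr by auto.
  rewrite (model_linear _ _ _ m); auto.
- intros v hv; apply (model_car _ _ _ m) in hv; destruct hv as [v' [hv <-]].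
  now rewrite (model_brk _ _ _ m), la, model_zero.
- intros u v w hu hv hw; apply (model_car _ _ _ m) in hu, hv, hw.
  destruct hu as [u' [hu <-]], hv as [v' [hv <-]], hw as [w' [hw <-]].
  rewrite !(model_brk _ _ _ m) by auto.
  rewrite <- !model_plus, lj, model_zero by auto; trivial.
Qed.

Lemma model_lincomb (l : list g) : (forall v, In v l -> lie_car g v) -> forall c,
  lie_car g (lincomb c l) /\ lincomb c (map F l) = F (lincomb c l).
Proof.
induction l as [| v l IH]; intros hl [| k c]; simpl;
  try (split; [apply lg | symmetry; apply model_zero]).
destruct (IH (fun w hw => hl w (or_intror hw)) c) as [h1 h2].
assert (hv := hl v (or_introl eq_refl)).
split; [apply lg; trivial; now apply lg |].
now rewrite (model_linear _ _ _ m), h2.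
Qed.

Lemma model_basis (l : list g) : is_basis g l -> is_basis h (map F l).
Proof.
intros [hl hb]; split.
- intros w hw; apply in_map_iff in hw; destruct hw as [v [<- hv]].
  now apply model_in, hl.
- intros w hw; apply (model_car _ _ _ m) in hw; destruct hw as [v [hv <-]].
  destruct (hb v hv) as [c [[cl cv] cu]]; exists c; split.
  + destruct (model_lincomb l hl c) as [_ ->]; now rewrite length_map, cv.
  + intros c' [cl' cv']; apply cu; rewrite length_map in cl'; split; trivial.
    destruct (model_lincomb l hl c') as [hc e]; rewrite e in cv'.
    now apply (model_inj _ _ _ m).
Qed.

(** The morphism in the theorem is a function on the whole ambient space. Off the image of [F] the
    choice operator returns an unspecified vector, which is harmless because morphisms are judged on
    [lie_car h]. *)
Definition model_inv (w : h) : g :=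
  epsilon (inhabits zero) (fun v => lie_car g v /\ F v = w).

Lemma model_invK v : lie_car g v -> model_inv (F v) = v.
Proof.
intros hv; unfold model_inv.
destruct (epsilon_spec (inhabits zero) (fun v' => lie_car g v' /\ F v' = F v))
  as [h1 h2]; [now exists v | now apply (model_inj _ _ _ m)].
Qed.

Lemma model_inv_morphism : is_lie_morphism h g model_inv.
Proof.
destruct lg as [l0 lp ls lc ll lr la lj].
split; [split |].
- intros w hw; apply (model_car _ _ _ m) in hw; destruct hw as [v [hv <-]].
  now rewrite model_invK.
- intros k v w hv hw; apply (model_car _ _ _ m) in hv, hw.
  destruct hv as [v' [hv <-]], hw as [w' [hw <-]].
  rewrite <- (model_linear _ _ _ m), !model_invK; auto.
- intros v w hv hw; apply (model_car _ _ _ m) in hv, hw.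
  destruct hv as [v' [hv <-]], hw as [w' [hw <-]].
  rewrite (model_brk _ _ _ m), !model_invK; auto.
Qed.

Lemma model_isomorphic : lie_isomorphic h g.
Proof.
exists model_inv; split; [apply model_inv_morphism | split].
- intros v w hv hw; apply (model_car _ _ _ m) in hv, hw.
  destruct hv as [v' [hv <-]], hw as [w' [hw <-]].
  rewrite !model_invK by trivial; now intros <-.
- intros v hv; exists (F v); split; [now apply model_in | now apply model_invK].
Qed.
End Model.

Lemma lie_isomorphic_model (g h k : lie_data) (F : g -> h) :
  lie_isomorphic k g -> lie_model g h F -> lie_isomorphic k h.
Proof.
intros [f [[[fc fl] fb] [fi fs]]] m; exists (fun v => F (f v)).
split; [split; [split |] | split].
- intros v hv; apply (model_in m); auto.
- intros c v w hv hw; rewrite fl, (model_linear _ _ _ m); auto.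
- intros v w hv hw; rewrite fb, (model_brk _ _ _ m); auto.
- intros v w hv hw e; apply fi; trivial; apply (model_inj _ _ _ m); auto.
- intros w hw; apply (model_car _ _ _ m) in hw; destruct hw as [v [hv <-]].
  destruct (fs v hv) as [u [hu <-]]; now exists u.
Qed.

(** The free scalars anticipate the prescribed images -b^2 F, (b/2) H and -b Y of v_2, v_3 and
    v_5. *)
Lemma M_basis (k1 k2 k3 : R) : k1 <> 0 -> k2 <> 0 -> k3 <> 0 ->
  is_basis M_alg [M_vec M_E; scal k1 (M_vec M_F); scal k2 (M_vec M_H); M_vec M_X;
    scal k3 (M_vec M_Y); M_vec M_Z].
Proof.
intros h1 h2 h3; split; [intros; exact I |]; intros v _.
exists [v M_E; v M_F / k1; v M_H / k2; v M_X; v M_Y / k3; v M_Z]; split.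
- split; [reflexivity |].
  apply functional_extensionality; intros []; cbn; unfold mult; simpl; now field.
- intros c [cl <-].
  destruct c as [| c1 [| c2 [| c3 [| c4 [| c5 [| c6 [| ]]]]]]]; try discriminate cl.
  cbn; unfold mult; simpl; repeat f_equal; now field.
Qed.

(** * Vector fields given by formulas *)

(* [is_derive_unique] with binders in [R] rather than in [R_AbsRing], so that it
   rewrites the derivatives left by [auto_derive]. *)
Lemma Derive_of (f : R -> R) (x l : R) :
  is_derive f x l -> Derive (fun s : R => f s) x = l.
Proof. apply is_derive_unique. Qed.

Section Jets.
Context {J : Type} `{Index J}.
Implicit Types (f g : (J -> R) -> R) (z : J -> R).

Lemma upd_same z j s : upd z j s j = s.
Proof. unfold upd; destruct (index_dec j j); easy. Qed.

Lemma upd_id z j : upd z j (z j) = z.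
Proof.
apply functional_extensionality; intros i; unfold upd.
destruct (index_dec i j) as [-> |]; easy.
Qed.

Lemma open_upd (D : (J -> R) -> Prop) z j :
  open D -> D z -> locally (z j) (fun s => D (upd z j s)).
Proof.
intros oD hz; destruct (oD z hz) as [eps he]; exists eps; intros s hs; apply he.
intros i; unfold upd; destruct (index_dec i j) as [-> | _]; [exact hs | apply ball_center].
Qed.

Lemma pd_ext_on (D : (J -> R) -> Prop) f g j z : open D -> D z ->
  (forall z, D z -> f z = g z) -> pd j f z = pd j g z.
Proof.
intros oD hz e; apply Derive_ext_loc.
generalize (open_upd D z j oD hz); apply filter_imp; intros s hs; now apply e.
Qed.

Lemma ex_pd_ext_on (D : (J -> R) -> Prop) f g j z : open D -> D z ->
  (forall z, D z -> f z = g z) -> ex_pd j f z -> ex_pd j g z.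
Proof.
intros oD hz e; apply ex_derive_ext_loc.
generalize (open_upd D z j oD hz); apply filter_imp; intros s hs; now apply e.
Qed.

Lemma class_C_ext_on (D : (J -> R) -> Prop) n : open D -> forall f g,
  (forall z, D z -> f z = g z) -> class_C n D f -> class_C n D g.
Proof.
intros oD; induction n as [| n IH]; intros f g e [hc hd]; (split;
  [intros z hz; apply (continuous_ext_loc _ f);
    [generalize (oD z hz); apply filter_imp; intros z' hz'; now apply e | now apply hc]
  | ]); [exact I |].
intros j; destruct (hd j) as [h1 h2]; split.
- intros z hz; apply (ex_pd_ext_on D f); auto.
- apply (IH (pd j f)); trivial; intros z hz; now apply (pd_ext_on D).
Qed.

(* Reified formulas: they are closed under partial derivatives, whence smoothness,
   and the latter are computed by [deriv]. *)
Inductive term :=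
  | Cst (c : R) | Var (j : J) | Add (a b : term) | Mul (a b : term)
  | Exp (a : term) | Sqrt (a : term) | Inv (a : term).

Fixpoint eval (a : term) z : R :=
  match a with
  | Cst c => c
  | Var j => z j
  | Add a b => eval a z + eval b z
  | Mul a b => eval a z * eval b z
  | Exp a => exp (eval a z)
  | Sqrt a => sqrt (eval a z)
  | Inv a => / eval a z
  end.

Fixpoint deriv (j : J) (a : term) : term :=
  match a with
  | Cst _ => Cst 0
  | Var i => Cst (if index_dec i j then 1 else 0)
  | Add a b => Add (deriv j a) (deriv j b)
  | Mul a b => Add (Mul (deriv j a) b) (Mul a (deriv j b))
  | Exp a => Mul (deriv j a) (Exp a)
  | Sqrt a => Mul (deriv j a) (Inv (Mul (Cst 2) (Sqrt a)))
  | Inv a => Mul (Cst (-1)) (Mul (deriv j a) (Mul (Inv a) (Inv a)))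
  end.

Fixpoint wf (D : (J -> R) -> Prop) (a : term) : Prop :=
  match a with
  | Cst _ | Var _ => True
  | Add a b | Mul a b => wf D a /\ wf D b
  | Exp a => wf D a
  | Sqrt a => wf D a /\ forall z, D z -> 0 < eval a z
  | Inv a => wf D a /\ forall z, D z -> eval a z <> 0
  end.

Lemma wf_deriv D j a : wf D a -> wf D (deriv j a).
Proof.
induction a as [c | i | a IHa b IHb | a IHa b IHb | a IHa | a IHa | a IHa];
  simpl; try tauto.
intros [w hp]; repeat split; auto.
intros z hz; assert (h := sqrt_lt_R0 _ (hp z hz)); lra.
Qed.

Lemma is_derive_eval D a : wf D a -> forall z j, D z ->
  is_derive (fun s => eval a (upd z j s)) (z j) (eval (deriv j a) z).
Proof.
intros w z j hz; revert w.
(* [F] hides [eval] and [upd], so that [auto_derive] sees unknown functions of one variable whose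
   derivatives are hypotheses. *)
set (F b s := eval b (upd z j s)).
assert (e : forall b, F b (z j) = eval b z) by (intros b; unfold F; now rewrite upd_id).
change (wf D a -> is_derive (F a) (z j) (eval (deriv j a) z)).
induction a as [c | i | a IHa b IHb | a IHa b IHb | a IHa | a IHa | a IHa];
  simpl; intros w.
- apply @is_derive_const.
- unfold F; simpl; unfold upd; destruct (index_dec i j);
    [apply @is_derive_id | apply @is_derive_const].
- apply (is_derive_plus (F a) (F b)); [apply IHa | apply IHb]; tauto.
- pose proof (IHa (proj1 w) : is_derive (fun s => F a s) (z j) _) as ha.
  pose proof (IHb (proj2 w) : is_derive (fun s => F b s) (z j) _) as hb.
  change (is_derive (fun s => F a s * F b s) (z j)
    (eval (deriv j a) z * eval b z + eval a z * eval (deriv j b) z)).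
  rewrite <- ?(e a), <- ?(e b); auto_derive; [repeat split; eexists; eassumption |].
  rewrite (Derive_of _ _ _ ha), (Derive_of _ _ _ hb); ring.
- pose proof (IHa w : is_derive (fun s => F a s) (z j) _) as ha.
  change (is_derive (fun s => exp (F a s)) (z j) (eval (deriv j a) z * exp (eval a z))).
  rewrite <- ?(e a), <- ?(e b); auto_derive; [repeat split; eexists; eassumption |].
  rewrite (Derive_of _ _ _ ha); ring.
- pose proof (IHa (proj1 w) : is_derive (fun s => F a s) (z j) _) as ha.
  assert (hp := proj2 w z hz).
  change (is_derive (fun s => sqrt (F a s)) (z j)
    (eval (deriv j a) z * / (2 * sqrt (eval a z)))).
  rewrite <- (e a) in *; auto_derive; [repeat split; trivial; eexists; eassumption |].
  rewrite (Derive_of _ _ _ ha); ring.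
- pose proof (IHa (proj1 w) : is_derive (fun s => F a s) (z j) _) as ha.
  assert (hp := proj2 w z hz).
  change (is_derive (fun s => / F a s) (z j)
    (-1 * (eval (deriv j a) z * (/ eval a z * / eval a z)))).
  rewrite <- (e a) in *; auto_derive; [repeat split; trivial; eexists; eassumption |].
  rewrite (Derive_of _ _ _ ha); now field.
Qed.

Lemma continuous_eval D a : wf D a -> forall z, D z -> continuous (eval a) z.
Proof.
induction a as [c | i | a IHa b IHb | a IHa b IHb | a IHa | a IHa | a IHa];
  simpl; intros w z hz.
- apply continuous_const.
- intros P [eps he]; exists eps; intros z' hz'; apply he, hz'.
- apply (continuous_plus (eval a) (eval b)); [apply IHa | apply IHb]; tauto.
- apply (continuous_mult (eval a) (eval b)); [apply IHa | apply IHb]; tauto.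
- apply (continuous_comp (eval a) exp); [now apply IHa | apply continuous_exp].
- apply (continuous_comp (eval a) sqrt); [now apply IHa | apply continuous_sqrt].
- apply (continuous_comp (eval a) Rinv); [now apply IHa |].
  apply continuous_Rinv; now apply w.
Qed.

Lemma pd_eval D a z j : wf D a -> D z -> pd j (eval a) z = eval (deriv j a) z.
Proof. intros w hz; now apply is_derive_unique, (is_derive_eval D). Qed.

Lemma class_C_eval D a n : open D -> wf D a -> class_C n D (eval a).
Proof.
intros oD; revert a; induction n as [| n IH]; intros a w;
  (split; [now apply continuous_eval |]); [exact I |].
intros j; split.
- intros z hz; eexists; now apply (is_derive_eval D).
(* The formal derivative is known to agree with [pd] on [D] only: elsewhere a root or an inverse may
   fail to be differentiable. *)
- apply (class_C_ext_on D n oD (eval (deriv j a))).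
  + intros z hz; symmetry; now apply (pd_eval D).
  + now apply IH, wf_deriv.
Qed.

Definition term_vfield (D : (J -> R) -> Prop) (e : J -> term) : vfield J :=
  ext0 D (fun z k => eval (e k) z).

Lemma term_vfieldE D e z k : D z -> term_vfield D e z k = eval (e k) z.
Proof.
intros hz; unfold term_vfield, ext0.
now destruct (excluded_middle_informative (D z)).
Qed.

Lemma term_vfield_out D e z k : ~ D z -> term_vfield D e z k = 0.
Proof.
intros hz; unfold term_vfield, ext0.
now destruct (excluded_middle_informative (D z)).
Qed.

Lemma term_vfield_smooth D e : open D -> (forall k, wf D (e k)) ->
  smooth_vfield D (term_vfield D e).
Proof.
intros oD w; split; [| intros z j; apply term_vfield_out].
intros j n; apply (class_C_ext_on D n oD (eval (e j))).
- intros z hz; symmetry; now apply term_vfieldE.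
- now apply class_C_eval.
Qed.

Lemma pd_term_vfield D e j k z : open D -> (forall k, wf D (e k)) -> D z ->
  pd j (fun z => term_vfield D e z k) z = eval (deriv j (e k)) z.
Proof.
intros oD w hz; rewrite (pd_ext_on D _ (eval (e k))); trivial.
- now apply (pd_eval D).
- intros z' hz'; now apply term_vfieldE.
Qed.

Lemma pd_pd_term_vfield D e i j k z : open D -> (forall k, wf D (e k)) -> D z ->
  pd i (pd j (fun z => term_vfield D e z k)) z = eval (deriv i (deriv j (e k))) z.
Proof.
intros oD w hz; rewrite (pd_ext_on D _ (eval (deriv j (e k)))); trivial.
- apply (pd_eval D); trivial; now apply wf_deriv.
- intros z' hz'; now apply pd_term_vfield.
Qed.

Lemma isum_ext (F G : J -> R) : (forall k, F k = G k) -> isum F = isum G.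
Proof. intros e; unfold isum; now rewrite (map_ext F G e). Qed.

Lemma isum_0 : isum (fun _ : J => 0) = 0.
Proof.
unfold isum; induction index_enum as [| j l IH]; simpl in *; [| rewrite IH]; ring.
Qed.

Lemma vbracket_term_vfield D (e e' e'' : J -> term) : open D ->
  (forall k, wf D (e k)) -> (forall k, wf D (e' k)) ->
  (forall z, D z -> forall k,
    isum (fun j => eval (e j) z * eval (deriv j (e' k)) z
                 - eval (e' j) z * eval (deriv j (e k)) z) = eval (e'' k) z) ->
  vbracket (term_vfield D e) (term_vfield D e') = term_vfield D e''.
Proof.
intros oD w w' h; apply functional_extensionality; intros z.
apply functional_extensionality; intros k; unfold vbracket.
destruct (excluded_middle_informative (D z)) as [hz | hz].
- rewrite term_vfieldE, <- h by trivial; apply isum_ext; intros j.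
  now rewrite !pd_term_vfield, !term_vfieldE.
(* At a boundary point of [D] the partial derivatives of the extension by zero may be meaningless,
   but each is multiplied by a coefficient that vanishes there. *)
- rewrite term_vfield_out by trivial; rewrite <- isum_0; apply isum_ext; intros j.
  rewrite !term_vfield_out by trivial; ring.
Qed.

Lemma is_derive_isum (F : J -> R -> R) (dF : J -> R) x :
  (forall k, is_derive (F k) x (dF k)) ->
  is_derive (fun s => isum (fun k => F k s)) x (isum dF).
Proof.
intros h; unfold isum; induction index_enum as [| j l IH]; simpl.
- apply @is_derive_const.
- apply @is_derive_plus; [apply h | apply IH].
Qed.

Definition kron (l k : J) : R := if index_dec l k then 1 else 0.

Lemma is_derive_upd (p : J -> R) k l :
  is_derive (fun s : R => upd p k s l) (p k) (kron l k).
Proof.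
unfold kron, upd; destruct (index_dec l k); [apply @is_derive_id | apply @is_derive_const].
Qed.
End Jets.

Arguments term : clear implicits.

(** * Prolongation *)

Section Prolongation.
Context {I : Type} `{Index I}.
Variables (D : (option I -> R) -> Prop) (v : vfield (option I)).
Hypothesis sv : smooth_vfield D v.

Lemma smooth_pd_pd i j k z : D z ->
  is_derive (fun s => pd i (fun z => v z k) (upd z j s)) (z j)
    (pd j (pd i (fun z => v z k)) z).
Proof.
intros hz; destruct (proj1 sv k 2%nat) as [_ h]; destruct (h i) as [_ [_ h']].
now apply Derive_correct, h'.
Qed.

Lemma pd_prolong1_z i j z p : D z ->
  pd j (fun z => prolong1 v i z p) z =
  pd j (pd (Some i) (fun z => v z None)) z
  + p i * pd j (pd None (fun z => v z None)) z
  - isum (fun k => p k * (pd j (pd (Some i) (fun z => v z (Some k))) z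
                          + p i * pd j (pd None (fun z => v z (Some k))) z)).
Proof.
intros hz; apply is_derive_unique; unfold prolong1, total_derivative0.
apply @is_derive_minus; [apply @is_derive_plus |].
- now apply smooth_pd_pd.
- apply (is_derive_scal (fun s => pd None (fun z' => v z' None) (upd z j s))).
  now apply smooth_pd_pd.
- apply is_derive_isum; intros k.
  apply (is_derive_scal (fun s => pd (Some i) (fun z' => v z' (Some k)) (upd z j s) +
    p i * pd None (fun z' => v z' (Some k)) (upd z j s))).
  apply @is_derive_plus; [now apply smooth_pd_pd |].
  apply (is_derive_scal (fun s => pd None (fun z' => v z' (Some k)) (upd z j s))).
  now apply smooth_pd_pd.
Qed.

Lemma pd_prolong1_p i k z p :
  pd k (fun p => prolong1 v i z p) p =
  kron i k * pd None (fun z => v z None) z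
  - isum (fun l => kron l k *
                     total_derivative0 i (fun z => v z (Some l)) z p
                   + p l * (kron i k *
                            pd None (fun z => v z (Some l)) z)).
Proof.
apply is_derive_unique; unfold prolong1, total_derivative0.
assert (hi := is_derive_upd p k i).
apply @is_derive_minus.
- revert hi; set (f := fun s : R => upd p k s i); intros hi.
  change (is_derive (fun s => pd (Some i) (fun z' => v z' None) z
    + f s * pd None (fun z' => v z' None) z) (p k)
    (kron i k * pd None (fun z => v z None) z)).
  clearbody f; auto_derive; [eexists; eassumption | rewrite (Derive_of _ _ _ hi); ring].
- apply is_derive_isum; intros l; assert (hl := is_derive_upd p k l).
  assert (ei : upd p k (p k) i = p i) by now rewrite upd_id.
  assert (el : upd p k (p k) l = p l) by now rewrite upd_id.
  revert hi hl ei el; set (f := fun s : R => upd p k s i); set (g := fun s : R => upd p k s l).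
  change (upd p k (p k) i) with (f (p k)); change (upd p k (p k) l) with (g (p k)).
  intros hi hl ei el.
  set (A := pd (Some i) (fun z' => v z' (Some l)) z).
  set (B := pd None (fun z' => v z' (Some l)) z).
  change (is_derive (fun s => g s * (A + f s * B)) (p k)
    (kron l k * (A + p i * B)
     + p l * (kron i k * B))).
  clearbody f g; auto_derive; [split; [| split; [| exact Logic.I]]; eexists; eassumption |].
  rewrite (Derive_of _ _ _ hi), (Derive_of _ _ _ hl), ei, el; ring.
Qed.
End Prolongation.

Section Expansion.
Context {I : Type} `{Index I}.
Variables (d : option I -> option I -> R) (d2 : option I -> option I -> option I -> R).

(* [d j k] stands for the derivative of the [k]-th coefficient with respect to
   the [j]-th coordinate, and [d2 i j k] for its second derivatives. *)
Definition prolong1_jet (i : I) (p : I -> R) : R :=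
  d (Some i) None + p i * d None None
  - isum (fun k => p k * (d (Some i) (Some k) + p i * d None (Some k))).

Definition prolong2_jet (i : I) (p : I -> R) (q : I -> I -> R) : R :=
  d2 (Some i) (Some i) None + p i * d2 (Some i) None None
  - isum (fun k => p k * (d2 (Some i) (Some i) (Some k) + p i * d2 (Some i) None (Some k)))
  + p i * (d2 None (Some i) None + p i * d2 None None None
    - isum (fun k => p k * (d2 None (Some i) (Some k) + p i * d2 None None (Some k))))
  + isum (fun k => q i k * (kron i k * d None None
      - isum (fun l => kron l k * (d (Some i) (Some l) + p i * d None (Some l))
                       + p l * (kron i k * d None (Some l)))))
  - isum (fun k => q i k * (d (Some i) (Some k) + p i * d None (Some k))).
End Expansion.

Definition jet1 {I} `{Index I} (v : vfield (option I)) z : option I -> option I -> R :=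
  fun j k => pd j (fun z => v z k) z.

Definition jet2 {I} `{Index I} (v : vfield (option I)) z :
  option I -> option I -> option I -> R :=
  fun i j k => pd i (pd j (fun z => v z k)) z.

(** Equal indices suffice because neither equation contains a mixed second derivative. The
    right-hand side is polynomial in [p] and [q], with the derivatives of [v] at [z] as atoms; this
    is the form in which coefficients are compared. *)
Lemma prolong2E {I} `{Index I} D (v : vfield (option I)) i z p q :
  smooth_vfield D v -> D z ->
  prolong2 v i i z p q = prolong2_jet (jet1 v z) (jet2 v z) i p q.
Proof.
intros sv hz; unfold prolong2, total_derivative1.
rewrite !(pd_prolong1_z D) by trivial; unfold prolong2_jet, total_derivative0.
f_equal; f_equal; apply isum_ext; intros k.
change (pd k (fun p' => prolong1 v i z p') p) with (pd k (prolong1 v i z) p).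
rewrite (pd_prolong1_p v i k z p); reflexivity.
Qed.

Lemma jet1_term {I} `{Index I} D e z : open D -> (forall k, wf D (e k)) -> D z ->
  jet1 (term_vfield D e) z = fun j k => eval (deriv j (e k)) z.
Proof.
intros oD w hz; do 2 (apply functional_extensionality; intros ?).
now apply pd_term_vfield.
Qed.

Lemma jet2_term {I} `{Index I} D e z : open D -> (forall k, wf D (e k)) -> D z ->
  jet2 (term_vfield D e) z = fun i j k => eval (deriv i (deriv j (e k))) z.
Proof.
intros oD w hz; do 3 (apply functional_extensionality; intros ?).
now apply pd_pd_term_vfield.
Qed.

Lemma pr2_heat D v z p q : smooth_vfield D v -> D z ->
  pr2 v Delta_heat z p q =
  prolong1_jet (jet1 v z) th_ p + prolong2_jet (jet1 v z) (jet2 v z) qh_ p q.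
Proof.
intros sv hz; unfold pr2, Delta_heat.
rewrite <- (prolong2E D) by trivial.
change (prolong1_jet (jet1 v z) th_ p) with (prolong1 v th_ z p).
apply is_derive_unique; generalize (prolong1 v th_ z p), (prolong2 v qh_ qh_ z p q).
intros A B; auto_derive; [trivial | ring].
Qed.

Lemma pr2_two_factor a b d e D v z p q : smooth_vfield D v -> D z ->
  pr2 v (Delta_two_factor a b d e) z p q =
  - b * v z (Some x_) * p x_
  + (a - b * z (Some x_)) * prolong1_jet (jet1 v z) x_ p
  - e * v z (Some y_) * p y_
  + (d - e * z (Some y_)) * prolong1_jet (jet1 v z) y_ p
  + v z (Some x_) / 2 * q x_ x_
  + z (Some x_) / 2 * prolong2_jet (jet1 v z) (jet2 v z) x_ p q
  + v z (Some y_) / 2 * q y_ y_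
  + z (Some y_) / 2 * prolong2_jet (jet1 v z) (jet2 v z) y_ p q
  + prolong1_jet (jet1 v z) t_ p.
Proof.
intros sv hz; unfold pr2, Delta_two_factor.
rewrite <- !(prolong2E D) by trivial.
change (prolong1_jet (jet1 v z) ?i p) with (prolong1 v i z p).
apply is_derive_unique.
generalize (prolong1 v x_ z p), (prolong1 v y_ z p), (prolong1 v t_ z p),
  (prolong2 v x_ x_ z p q), (prolong2 v y_ y_ z p q).
intros A B C E F; auto_derive; [trivial | field].
Qed.

(** * The symmetries found by solving the determining equations *)

Lemma open_univ (J : Type) : open (fun _ : J -> R => True).
Proof. apply open_true. Qed.

(** E is the projective symmetry, -F the time translation, H the dilation, X the Galilean boost, -Y
    the space translation. The brackets [E, F] = H and [X, Y] = Z force the term -u/2 in H and make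
    Z equal to half of u d/du. *)
Definition heat_term (A : M_space) (k : option tq) : term (option tq) :=
  let t := Var (Some th_) in let q := Var (Some qh_) in let c i := Cst (A i) in
  match k with
  | Some th_ => Add (Mul (c M_E) (Mul t t))
                  (Add (Mul (Cst (-1)) (c M_F)) (Mul (Mul (Cst 2) (c M_H)) t))
  | Some qh_ => Add (Mul (c M_E) (Mul t q)) (Add (Mul (c M_H) q)
                  (Add (Mul (c M_X) t) (Mul (Cst (-1)) (c M_Y))))
  | None => Mul (Add (Mul (c M_E) (Add (Mul (Cst (1 / 4)) (Mul q q)) (Mul (Cst (- 1 / 2)) t)))
              (Mul (Cst (1 / 2)) (Add (Mul (Cst (-1)) (c M_H))
                (Add (Mul (c M_X) q) (c M_Z))))) (Var None)
  end.

Definition heat_field (A : M_space) : H00_alg :=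
  term_vfield (fun _ => True) (heat_term A).

Lemma wf_heat A k : wf (fun _ => True) (heat_term A k).
Proof. destruct k as [[] |]; simpl; tauto. Qed.

Lemma heat_field_symmetry A : lie_car H00_alg (heat_field A).
Proof.
assert (sv : smooth_vfield (fun _ => True) (heat_field A))
  by (apply term_vfield_smooth; [apply open_univ | apply wf_heat]).
split; [split; [exact sv |] |].
- intros z p q hz sq h; rewrite (pr2_heat (fun _ => True)) by trivial.
  unfold heat_field; rewrite jet1_term, jet2_term
    by (apply open_univ || apply wf_heat || trivial).
  unfold Delta_heat in h; assert (ht : p th_ = - q qh_ qh_) by lra.
  unfold prolong1_jet, prolong2_jet, isum, kron; cbn.
  rewrite ht; field.
- exists (fun x => A M_E * (x qh_ * x qh_ / 4 - x th_ / 2) + (- A M_H + A M_X * x qh_ + A M_Z) / 2),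
    (fun _ => 0); split; [| trivial].
  intros z _; unfold heat_field; rewrite term_vfieldE by trivial.
  unfold indep; simpl; field.
Qed.

Lemma heat_field_bracket A B :
  vbracket (heat_field A) (heat_field B) = heat_field (M_bracket A B).
Proof.
apply vbracket_term_vfield; [apply open_univ | apply wf_heat | apply wf_heat |].
intros z _ k; rewrite M_bracketE; unfold isum.
destruct k as [[] |]; cbn; field.
Qed.

Lemma open_quadrant : open quadrant.
Proof.
apply (open_and (fun z => 0 < z (Some x_)) (fun z => 0 < z (Some y_)));
  [apply (open_comp (fun z : option xyt -> R => z (Some x_)) (fun s => 0 < s))
  | apply (open_comp (fun z : option xyt -> R => z (Some y_)) (fun s => 0 < s))];
  try apply open_gt; intros z _ P [eps he]; exists eps; intros z' hz'; apply he, hz'.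
Qed.

Section TwoFactor.
Variables b d : R.
Hypothesis b0 : b <> 0.

(* The coefficient of [u] is (x + y) (tau'' + b tau') - (1/4 + d) (tau' + b tau)
   + sqrt x (2 alpha' + b alpha) + const, where tau and sqrt x * alpha + x * tau' are
   the coefficients of t and x. *)
Definition two_factor_term (A : M_space) (k : option xyt) : term (option xyt) :=
  let x := Var (Some x_) in let y := Var (Some y_) in
  let E := Exp (Mul (Cst (b / 2)) (Var (Some t_))) in
  let p := Mul E E in let n := Inv p in
  let tau' := Add (Mul (Cst (b * A M_E)) p) (Mul (Cst (A M_F / b)) n) in
  match k with
  | Some t_ => Add (Mul (Cst (A M_E)) p)
                 (Add (Mul (Cst (- A M_F / (b * b))) n) (Cst (2 / b * A M_H)))
  | Some x_ => Add (Mul x tau') (Mul (Sqrt x)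
                 (Add (Mul (Cst (A M_X)) E) (Mul (Cst (- A M_Y / b)) (Inv E))))
  | Some y_ => Mul y tau'
  | None => Mul (Add (Mul (Cst (2 * b * A M_E))
                       (Mul p (Add (Mul (Cst b) (Add x y)) (Cst (- (1 / 4 + d))))))
                  (Add (Cst (A M_Z - 2 * (1 / 4 + d) * A M_H))
                    (Mul (Sqrt x) (Mul (Cst (2 * b * A M_X)) E)))) (Var None)
  end.

(** This inverts the map of the theorem: E, F, H, X, Y, Z go to v_1, -v_2 / b^2, (2/b) v_3, v_4,
    -v_5 / b, v_6. Writing every exponential through exp(bt/2) makes all later identities rational
    in that quantity and in sqrt x, hence accessible to [field]. *)
Definition two_factor_field (A : M_space) : vfield (option xyt) :=
  term_vfield quadrant (two_factor_term A).

Lemma wf_two_factor A k : wf quadrant (two_factor_term A k).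
Proof.
assert (hE : forall t, exp t * exp t <> 0)
  by (intros t; apply Rgt_not_eq, Rmult_lt_0_compat; apply exp_pos).
assert (hE1 : forall t, exp t <> 0) by (intros t; apply Rgt_not_eq, exp_pos).
destruct k as [[] |]; simpl; repeat split; auto; now intros z [].
Qed.

Lemma two_factor_field_symmetry A : lie_car (L_alg (1 / 4) b d b) (two_factor_field A).
Proof.
assert (sv : smooth_vfield quadrant (two_factor_field A))
  by (apply term_vfield_smooth; [apply open_quadrant | apply wf_two_factor]).
split; [split; [exact sv |] |].
- intros z p q hz sq h; rewrite (pr2_two_factor _ _ _ _ quadrant) by trivial.
  unfold two_factor_field; rewrite jet1_term, jet2_term
    by (apply open_quadrant || apply wf_two_factor || trivial).
  rewrite !term_vfieldE by trivial.
  unfold Delta_two_factor in h.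
  set (x := z (Some x_)) in *; set (y := z (Some y_)) in *.
  assert (ht : p t_ = - ((1 / 4 - b * x) * p x_ + (d - b * y) * p y_ +
     x / 2 * q x_ x_ + y / 2 * q y_ y_)) by lra.
  unfold prolong1_jet, prolong2_jet, isum, kron; cbn.
  rewrite ht, (sq y_ x_); destruct hz as [hx hy]; fold x in hx; fold y in hy.
  fold x y.
  assert (hr := sqrt_lt_R0 _ hx).
  (* With r = sqrt x as the variable and exp(bt/2) generalized to a positive number, the symmetry
     condition is an identity of rational functions. *)
  replace x with (sqrt x * sqrt x) by (apply sqrt_sqrt; lra).
  rewrite sqrt_square by lra.
  assert (he := exp_pos (b / 2 * z (Some t_))).
  generalize dependent (sqrt x); generalize dependent (exp (b / 2 * z (Some t_))).
  intros E hE r hr; field; repeat split; lra.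
(* The u-coefficient is homogeneous of degree one in u, so lambda is its value at u = 1. *)
- exists (fun z => eval (two_factor_term A None)
      (fun k => match k with Some i => z i | None => 1 end)),
    (fun _ => 0); split; [| trivial].
  intros z hz; unfold two_factor_field; rewrite term_vfieldE by trivial.
  unfold indep; simpl; ring.
Qed.

Lemma two_factor_field_bracket A B :
  vbracket (two_factor_field A) (two_factor_field B) = two_factor_field (M_bracket A B).
Proof.
apply vbracket_term_vfield;
  [apply open_quadrant | apply wf_two_factor | apply wf_two_factor |].
intros z [hx hy] k; rewrite M_bracketE; unfold isum.
destruct k as [[] |]; cbn;
  assert (hr := sqrt_lt_R0 _ hx);
  assert (hr2 := sqrt_sqrt (z (Some x_)) (Rlt_le _ _ hx));
  generalize dependent (sqrt (z (Some x_))); intros r hr <-;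
  assert (he := exp_pos (b / 2 * z (Some t_)));
  generalize dependent (exp (b / 2 * z (Some t_))); intros E hE;
  field; repeat split; lra.
Qed.
End TwoFactor.

(** * Ordinary differential equations *)

Lemma derive_zero_const (P : R -> Prop) (f : R -> R) :
  (forall a b s, P a -> P b -> a <= s <= b -> P s) ->
  (forall s, P s -> is_derive f s 0) -> forall a b, P a -> P b -> f a = f b.
Proof.
intros cP h a b pa pb; destruct (Rtotal_order a b) as [l | [-> | l]]; trivial.
- apply eq_is_derive; trivial; intros t ht; apply h, (cP a b); trivial.
- symmetry; apply eq_is_derive; trivial; intros t ht; apply h, (cP b a); trivial.
Qed.

Lemma same_derive (P : R -> Prop) (f g df : R -> R) :
  (forall a b s, P a -> P b -> a <= s <= b -> P s) ->
  (forall s, P s -> is_derive f s (df s)) -> (forall s, P s -> is_derive g s (df s)) ->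
  forall a b, P a -> P b -> f a - f b = g a - g b.
Proof.
intros cP hf hg a b pa pb.
assert (e : f a - g a = f b - g b); [| lra].
apply (derive_zero_const P (fun s => f s - g s)); trivial; intros s ps.
replace 0 with (df s - df s) by ring; apply @is_derive_minus; auto.
Qed.

Lemma is_derive_val (f : R -> R) x l l' : is_derive f x l -> l = l' -> is_derive f x l'.
Proof. now intros h <-. Qed.

(** The usual application has for [l] an entry of the jet of an unknown symmetry, and for [g] an
    explicit formula that matches the coefficient for positive arguments. *)
Lemma is_derive_unique_loc (P : R -> Prop) (f g : R -> R) x l l' :
  open P -> P x -> is_derive f x l -> (forall s, P s -> f s = g s) ->
  is_derive g x l' -> l = l'.
Proof.
intros oP px hf e hg; rewrite <- (is_derive_unique _ _ _ hf), <- (is_derive_unique _ _ _ hg).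
apply Derive_ext_loc; generalize (oP x px); now apply filter_imp.
Qed.

Lemma is_derive_unique_ext (f g : R -> R) x l l' :
  is_derive f x l -> (forall s, f s = g s) -> is_derive g x l' -> l = l'.
Proof.
intros hf e hg; rewrite <- (is_derive_unique _ _ _ hf), <- (is_derive_unique _ _ _ hg).
now apply Derive_ext.
Qed.

Lemma positive_convex a c s : 0 < a -> 0 < c -> a <= s <= c -> 0 < s.
Proof. lra. Qed.

Lemma sqrt_pos_eq s : 0 < s -> exists r, 0 < r /\ s = r * r /\ sqrt s = r.
Proof.
intros hs; exists (sqrt s); repeat split; [now apply sqrt_lt_R0 |].
symmetry; apply sqrt_sqrt; lra.
Qed.

(** The equation says that f / sqrt s - k sqrt s has derivative zero, and its value at s = 1 is f 1
    - k. It is applied with k = tau', separately in x and in y. *)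
Lemma scaling_solution (f df : R -> R) k :
  (forall s, 0 < s -> is_derive f s (df s)) ->
  (forall s, 0 < s -> s * df s = f s / 2 + s / 2 * k) ->
  forall s, 0 < s -> f s = s * k + sqrt s * (f 1 - k).
Proof.
intros hf h s hs.
assert (e := derive_zero_const (fun s => 0 < s) (fun s => f s / sqrt s - sqrt s * k)
  positive_convex); simpl in e.
assert (e' : f s / sqrt s - sqrt s * k = f 1 / sqrt 1 - sqrt 1 * k).
{ apply e; try lra; intros r hr; assert (hr' := sqrt_lt_R0 _ hr).
  assert (hd := hf r hr).
  auto_derive; [repeat split; trivial; try lra; eexists; eassumption |].
  rewrite (Derive_of _ _ _ hd).
  assert (e1 : df r = (f r / 2 + r / 2 * k) / r) by (rewrite <- h by trivial; field; lra).
  rewrite e1; clear hd; destruct (sqrt_pos_eq r hr) as [q [hq [h1 h2]]]; rewrite h2.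
  generalize (f r); intros y; rewrite h1; field; lra. }
destruct (sqrt_pos_eq s hs) as [q [hq [h1 h2]]].
rewrite sqrt_1, h2 in e'; rewrite h2.
generalize dependent (f s); generalize (f 1); intros f1 fs e'; rewrite h1.
replace fs with (q * (fs / q - q * k) + q * q * k) by (field; lra).
rewrite e'; field.
Qed.

(* [(f' + k f) exp (- k t)] and [(f' - k f) exp (k t)] are constant. *)
Lemma exponential_solution (f f1 : R -> R) k : k <> 0 ->
  (forall s : R, is_derive f s (f1 s)) -> (forall s : R, is_derive f1 s (k ^ 2 * f s)) ->
  forall t, f t = (f 0 + f1 0 / k) / 2 * exp (k * t) + (f 0 - f1 0 / k) / 2 * / exp (k * t).
Proof.
intros hk hf hf1 t.
assert (hE : forall t, exp (k * t) <> 0) by (intros; apply Rgt_not_eq, exp_pos).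
assert (e1 := derive_zero_const (fun _ => True) (fun s => (f1 s + k * f s) / exp (k * s))).
assert (e2 := derive_zero_const (fun _ => True) (fun s => (f1 s - k * f s) * exp (k * s))).
simpl in e1, e2.
assert (e1' : (f1 t + k * f t) / exp (k * t) = (f1 0 + k * f 0) / exp (k * 0)).
{ apply e1; trivial; intros s _; assert (h1 := hf s); assert (h2 := hf1 s).
  auto_derive; [repeat split; trivial; eexists; eassumption |].
  rewrite (Derive_of _ _ _ h1), (Derive_of _ _ _ h2); field; apply hE. }
assert (e2' : (f1 t - k * f t) * exp (k * t) = (f1 0 - k * f 0) * exp (k * 0)).
{ apply e2; trivial; intros s _; assert (h1 := hf s); assert (h2 := hf1 s).
  auto_derive; [repeat split; trivial; eexists; eassumption |].
  rewrite (Derive_of _ _ _ h1), (Derive_of _ _ _ h2); ring. }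
rewrite Rmult_0_r, exp_0 in e1', e2'; specialize (hE t).
(* The two first integrals, each multiplied by the exponential that it lacks, differ by 2 k f. *)
replace (f t) with (((f1 t + k * f t) / exp (k * t) * exp (k * t)
  - (f1 t - k * f t) * exp (k * t) / exp (k * t)) / (2 * k)) by (field; auto).
rewrite e1', e2'; field; auto.
Qed.

Section SmoothField.
Context {J : Type} `{Index J}.

Lemma upd_other (z : J -> R) i j s : i <> j -> upd z j s i = z i.
Proof. unfold upd; destruct (index_dec i j); easy. Qed.

Variables (D : (J -> R) -> Prop).
Hypothesis oD : open D.

Lemma upd_upd (z : J -> R) j s s' : upd (upd z j s) j s' = upd z j s'.
Proof.
apply functional_extensionality; intros i; unfold upd; now destruct (index_dec i j).
Qed.

Lemma upd_comm (z : J -> R) i j s s' : i <> j ->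
  upd (upd z i s) j s' = upd (upd z j s') i s.
Proof.
intros ne; apply functional_extensionality; intros k; unfold upd.
destruct (index_dec k j), (index_dec k i); congruence.
Qed.

Lemma is_derive_line (f : (J -> R) -> R) z j s :
  class_C 1 D f -> D (upd z j s) ->
  is_derive (fun s => f (upd z j s)) s (pd j f (upd z j s)).
Proof.
intros [_ h] hz; destruct (h j) as [h1 _]; specialize (h1 _ hz).
unfold ex_pd in h1; apply Derive_correct in h1; rewrite upd_same in h1.
unfold pd; rewrite upd_same; revert h1; apply is_derive_ext; intros s'; now rewrite upd_upd.
Qed.

(** One sequence holds all derivatives along the line, so that the equations tau''' = b^2 tau' and
    alpha'' = (b/2)^2 alpha can be stated and differentiated freely. *)
Lemma smooth_line (f : (J -> R) -> R) z j :
  (forall n, class_C n D f) -> (forall s, D (upd z j s)) ->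
  exists F : nat -> R -> R, (forall s, F O s = f (upd z j s)) /\
    forall n s, is_derive (F n) s (F (S n) s).
Proof.
intros hf hz.
assert (hn : forall n m, class_C m D (Nat.iter n (pd j) f)).
{ intros n; induction n as [| n IH]; [exact hf |]; intros m.
  destruct (IH (S m)) as [_ h]; apply h. }
exists (fun n s => Nat.iter n (pd j) f (upd z j s)); split; [reflexivity |].
intros n s; apply is_derive_line; auto.
Qed.

Lemma pd_zero_on (f : (J -> R) -> R) j z : D z -> (forall z, D z -> f z = 0) -> pd j f z = 0.
Proof.
intros hz h; rewrite (pd_ext_on D f (fun _ => 0)) by trivial; apply (Derive_const 0).
Qed.

Lemma pd_zero_const (f : (J -> R) -> R) z j s s' :
  (forall a b r, D (upd z j a) -> D (upd z j b) -> a <= r <= b -> D (upd z j r)) ->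
  class_C 1 D f -> (forall z, D z -> pd j f z = 0) ->
  D (upd z j s) -> D (upd z j s') -> f (upd z j s) = f (upd z j s').
Proof.
intros cD hf h hs hs'.
apply (derive_zero_const (fun s => D (upd z j s)) (fun s => f (upd z j s))); trivial.
intros r hr; rewrite <- (h (upd z j r)) by trivial; now apply is_derive_line.
Qed.
End SmoothField.

Lemma indep_upd {I} `{Index I} (z : option I -> R) s : indep (upd z None s) = indep z.
Proof.
apply functional_extensionality; intros i; unfold indep, upd.
now destruct (index_dec (Some i) None).
Qed.

Section LinearCoefficient.
Context {I : Type} `{Index I}.
Variables (D : (option I -> R) -> Prop) (phi : (option I -> R) -> R) (la : (I -> R) -> R).
Hypotheses (oD : open D) (cD : forall z s, D z -> D (upd z None s)).
Hypothesis (phi_la : forall z, D z -> phi z = la (indep z) * z None).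

Lemma pd_u_phi z : D z -> pd None phi z = la (indep z).
Proof.
intros hz; apply is_derive_unique.
apply (is_derive_ext (fun s => la (indep z) * s)).
- intros s; rewrite phi_la, indep_upd, upd_same by auto; reflexivity.
- auto_derive; [trivial | ring].
Qed.

(** Both mixed derivatives of la u in u and the i-th variable are the i-th derivative of [la], which
    on the slice u = 1 is that of [phi]. Nothing is known about the regularity of [la], so
    everything is phrased through [phi] on that slice. *)
Lemma pd_i_u_phi i z : D z -> z None = 1 ->
  pd (Some i) (pd None phi) z = pd (Some i) phi z.
Proof.
intros hz h1; apply Derive_ext_loc.
generalize (open_upd D z (Some i) oD hz); apply filter_imp; intros s hs.
rewrite pd_u_phi, phi_la by trivial; rewrite upd_other, h1 by discriminate; ring.
Qed.

Lemma pd_u_i_phi i z : D z -> z None = 1 ->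
  pd None (pd (Some i) phi) z = pd (Some i) phi z.
Proof.
intros hz h1; apply is_derive_unique.
apply (is_derive_ext (fun s => s * pd (Some i) phi z));
  [| auto_derive; [trivial | ring]].
intros s; unfold pd at 1 2; rewrite <- Derive_scal.
replace (upd z None s (Some i)) with (z (Some i)) by reflexivity.
apply Derive_ext_loc.
generalize (open_upd D z (Some i) oD hz); apply filter_imp; intros r hr.
rewrite upd_comm, !phi_la by (discriminate || auto); rewrite indep_upd, upd_same.
rewrite upd_other, h1 by discriminate; ring.
Qed.
End LinearCoefficient.

(** * Classification for the heat equation *)

Definition point_tq (t q u : R) : option tq -> R :=
  fun k => match k with Some th_ => t | Some qh_ => q | None => u end.

Lemma point_tq_eta z : z = point_tq (z (Some th_)) (z (Some qh_)) (z None).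
Proof. now apply functional_extensionality; intros [[] |]. Qed.

Lemma upd_tq_t t q u s : upd (point_tq t q u) (Some th_) s = point_tq s q u.
Proof. now apply functional_extensionality; intros [[] |]. Qed.
Lemma upd_tq_q t q u s : upd (point_tq t q u) (Some qh_) s = point_tq t s u.
Proof. now apply functional_extensionality; intros [[] |]. Qed.
Lemma upd_tq_u t q u s : upd (point_tq t q u) None s = point_tq t q s.
Proof. now apply functional_extensionality; intros [[] |]. Qed.

Section HeatClassification.
Variable v : vfield (option tq).
Hypothesis sv : lie_car H00_alg v.

Local Notation comp k := (fun z => v z k).
Local Notation tt := (Some th_).
Local Notation qq := (Some qh_).

Lemma heat_smooth n k : class_C n (fun _ => True) (comp k).
Proof. apply sv. Qed.

Lemma heat_la : exists la : (tq -> R) -> R,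
  forall z, True -> v z None = la (indep z) * z None.
Proof.
destruct (proj2 sv) as [la [mu [h1 h2]]]; exists la; intros z hz.
rewrite h1, h2 by trivial; apply Rplus_0_r.
Qed.

(** A parametrization of the jets with Delta = 0: u_q = p, u_qq = q and u_tq = w are free, u_t = -q,
    and u_tt, which does not enter the prolonged equation, is set to 0. *)
Lemma heat_eq z p q w :
  let pp i := match i with th_ => - q | qh_ => p end in
  let qqs i j := match i, j with qh_, qh_ => q | th_, th_ => 0 | _, _ => w end in
  prolong1_jet (jet1 v z) th_ pp + prolong2_jet (jet1 v z) (jet2 v z) qh_ pp qqs = 0.
Proof.
intros pp qqs; rewrite <- (pr2_heat (fun _ => True)); trivial; [| apply sv].
apply sv; trivial; [intros [] []; reflexivity |].
unfold Delta_heat; cbn; ring.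
Qed.

(** The condition is a polynomial in (p, q, w) whose coefficients are linear in the derivatives of
    [v] at [z]. Its values at a few numerical triples replace the comparison of coefficients by
    linear arithmetic. *)
Ltac heat_coef z l :=
  let H := fresh in
  pose proof (heat_eq z) as H; unfold prolong1_jet, prolong2_jet, isum, kron in H; cbn in H;
  let rec go l := lazymatch l with
    | nil => idtac
    | cons (?p, ?q, ?w) ?l' => pose proof (H p q w); go l'
    end in go l; clear H.

Lemma heat_tau_first_order z : jet1 v z qq tt = 0 /\ jet1 v z None tt = 0.
Proof.
(* Changing w from 0 to 1 isolates the coefficient of u_tq, namely -2 (tau_q + u_q tau_u), at u_q =
   0 and at u_q = 1. *)
heat_coef z [(0, 0, 0); (0, 0, 1); (1, 0, 0); (1, 0, 1)].
split; lra.
Qed.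

Lemma heat_tau_second_order z i j : j = qq \/ j = None -> jet2 v z i j tt = 0.
Proof.
intros h; apply (pd_zero_on (fun _ => True)); [apply open_univ | trivial |].
intros z' _; destruct h as [-> | ->]; apply (heat_tau_first_order z').
Qed.

(** These are the coefficients of u_q u_qq and of u_qq. *)
Lemma heat_xi_first_order z : jet1 v z None qq = 0 /\ jet1 v z tt tt = 2 * jet1 v z qq qq.
Proof.
destruct (heat_tau_first_order z) as [t1 t2].
assert (t3 := heat_tau_second_order z qq qq (or_introl eq_refl)).
assert (t4 := heat_tau_second_order z qq None (or_intror eq_refl)).
assert (t5 := heat_tau_second_order z None qq (or_introl eq_refl)).
assert (t6 := heat_tau_second_order z None None (or_intror eq_refl)).
heat_coef z [(0, 0, 0); (0, 1, 0); (1, 0, 0); (1, 1, 0)].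
rewrite t1, t2, t3, t4, t5, t6 in *; split; lra.
Qed.

Lemma heat_phi_order_two z : z None = 1 ->
  2 * jet1 v z qq None = jet2 v z qq qq qq + jet1 v z tt qq /\
  jet1 v z tt None + jet2 v z qq qq None = 0.
Proof.
intros h1.
destruct (heat_tau_first_order z) as [t1 t2].
assert (t3 := heat_tau_second_order z qq qq (or_introl eq_refl)).
assert (t4 := heat_tau_second_order z qq None (or_intror eq_refl)).
assert (t5 := heat_tau_second_order z None qq (or_introl eq_refl)).
assert (t6 := heat_tau_second_order z None None (or_intror eq_refl)).
destruct (heat_xi_first_order z) as [t7 t8].
destruct heat_la as [la hla].
assert (t9 : jet2 v z qq None None = jet1 v z qq None)
  by (apply (pd_i_u_phi (fun _ => True) _ la); auto; [apply open_univ]).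
assert (t10 : jet2 v z None qq None = jet1 v z qq None)
  by (apply (pd_u_i_phi (fun _ => True) _ la); auto; [apply open_univ]).
(* At u_qq = u_tq = 0 the condition is a cubic in u_q; these values of u_q separate its constant and
   linear terms from the terms in phi_uu and xi_uu. *)
heat_coef z [(0, 0, 0); (1, 0, 0); (-1, 0, 0); (2, 0, 0); (-2, 0, 0)].
rewrite t1, t2, t3, t4, t5, t6, t7, t9, t10 in *; split; lra.
Qed.

Lemma heat_at_one t q u : v (point_tq t q u) tt = v (point_tq t 0 1) tt /\
  v (point_tq t q u) qq = v (point_tq t q 1) qq /\
  v (point_tq t q u) None = v (point_tq t q 1) None * u.
Proof.
repeat split.
- transitivity (v (point_tq t q 1) tt).
  + rewrite <- (upd_tq_u t q 1 u); rewrite <- (upd_tq_u t q 1 1) at 2.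
    apply (pd_zero_const (fun _ => True) (comp tt)); auto using heat_smooth.
    intros z _; apply heat_tau_first_order.
  + rewrite <- (upd_tq_q t 0 1 q); rewrite <- (upd_tq_q t 0 1 0) at 2.
    apply (pd_zero_const (fun _ => True) (comp tt)); auto using heat_smooth.
    intros z _; apply heat_tau_first_order.
- rewrite <- (upd_tq_u t q 1 u); rewrite <- (upd_tq_u t q 1 1) at 2.
  apply (pd_zero_const (fun _ => True) (comp qq)); auto using heat_smooth.
  intros z _; apply heat_xi_first_order.
- destruct heat_la as [la hla]; rewrite !hla by trivial; simpl.
  rewrite <- (upd_tq_u t q 1 u), indep_upd; ring.
Qed.

Lemma heat_smooth_t k q : exists F : nat -> R -> R,
  (forall s, F O s = v (point_tq s q 1) k) /\ forall n s, is_derive (F n) s (F (S n) s).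
Proof.
destruct (smooth_line (fun _ => True) (comp k) (point_tq 0 q 1) tt) as [F [h1 h2]];
  auto using heat_smooth.
exists F; split; trivial; intros s; now rewrite h1, upd_tq_t.
Qed.

Lemma heat_derive_q k t q u :
  is_derive (fun s => v (point_tq t s u) k) q (jet1 v (point_tq t q u) qq k).
Proof.
generalize (is_derive_line (fun _ => True) (comp k) (point_tq t 0 u) qq q (heat_smooth 1 k) I).
unfold jet1; rewrite upd_tq_q; apply is_derive_ext; intros s; now rewrite upd_tq_q.
Qed.

Lemma heat_derive_t k t q u :
  is_derive (fun s => v (point_tq s q u) k) t (jet1 v (point_tq t q u) tt k).
Proof.
generalize (is_derive_line (fun _ => True) (comp k) (point_tq 0 q u) tt t (heat_smooth 1 k) I).
unfold jet1; rewrite upd_tq_t; apply is_derive_ext; intros s; now rewrite upd_tq_t.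
Qed.

Lemma heat_classification : exists A, heat_field A = v.
Proof.
destruct (heat_smooth_t tt 0) as [T [hT dT]].
destruct (heat_smooth_t qq 0) as [al [hal dal]].
destruct (heat_smooth_t None 0) as [si [hsi dsi]].
assert (hxi : forall t q, v (point_tq t q 1) qq = q * T 1%nat t / 2 + al 0%nat t).
{ intros t q.
  assert (e := same_derive (fun _ => True) (fun s => v (point_tq t s 1) qq)
    (fun s => s * T 1%nat t / 2) (fun _ => T 1%nat t / 2)).
  simpl in e; specialize (e (fun _ _ _ _ _ _ => I)).
  rewrite hal; enough (v (point_tq t q 1) qq - v (point_tq t 0 1) qq
    = q * T 1%nat t / 2 - 0 * T 1%nat t / 2) by lra.
  apply e; trivial; intros s _; [| auto_derive; [trivial | field]].
  apply (is_derive_val _ _ _ _ (heat_derive_q qq t s 1)).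
  destruct (heat_xi_first_order (point_tq t s 1)) as [_ h].
  enough (jet1 v (point_tq t s 1) tt tt = T 1%nat t) by lra.
  apply (is_derive_unique_ext _ (T 0%nat) _ _ _ (heat_derive_t tt t s 1)); trivial.
  intros r; rewrite hT; apply heat_at_one. }
assert (hxit : forall t q, jet1 v (point_tq t q 1) tt qq = q * T 2%nat t / 2 + al 1%nat t).
{ intros t q; pose proof (dT 1%nat t) as h1; pose proof (dal 0%nat t) as h2.
  apply (is_derive_unique_ext _ _ _ _ _ (heat_derive_t qq t q 1) (fun s => hxi s q)).
  auto_derive; [repeat split; eexists; eassumption |].
  rewrite (Derive_of _ _ _ h1), (Derive_of _ _ _ h2); field. }
assert (hxiqq : forall t q, jet2 v (point_tq t q 1) qq qq qq = 0).
{ intros t q; unfold jet2; rewrite (pd_ext_on (fun _ => True) _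
    (fun z => T 1%nat (z tt) / 2)); [apply (Derive_const (T 1%nat t / 2))
    | apply open_univ | trivial |].
  intros z _; rewrite (point_tq_eta z); generalize (z tt) (z qq) (z None); clear z t q.
  intros t q u; simpl.
  apply (is_derive_unique_ext _ (fun s => s * T 1%nat t / 2 + al 0%nat t) _ _ _
    (heat_derive_q qq t q u)).
  - intros s; rewrite <- hxi; apply heat_at_one.
  - auto_derive; [trivial | field]. }
assert (hphiq : forall t q, jet1 v (point_tq t q 1) qq None = q * T 2%nat t / 4 + al 1%nat t / 2).
{ intros t q; destruct (heat_phi_order_two (point_tq t q 1) eq_refl) as [h _].
  rewrite hxiqq, hxit in h; lra. }
assert (hphi : forall t q, v (point_tq t q 1) None =
  q ^ 2 * T 2%nat t / 8 + q * al 1%nat t / 2 + si 0%nat t).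
{ intros t q; rewrite hsi.
  assert (e := same_derive (fun _ => True) (fun s => v (point_tq t s 1) None)
    (fun s => s ^ 2 * T 2%nat t / 8 + s * al 1%nat t / 2)
    (fun s => s * T 2%nat t / 4 + al 1%nat t / 2)).
  simpl in e; specialize (e (fun _ _ _ _ _ _ => I)).
  enough (v (point_tq t q 1) None - v (point_tq t 0 1) None
    = q ^ 2 * T 2%nat t / 8 + q * al 1%nat t / 2
      - (0 ^ 2 * T 2%nat t / 8 + 0 * al 1%nat t / 2)) by lra.
  simpl; apply e; trivial; intros s _; [| auto_derive; [trivial | field]].
  rewrite <- hphiq; apply heat_derive_q. }
assert (hphit : forall t q, jet1 v (point_tq t q 1) tt None =
  q ^ 2 * T 3%nat t / 8 + q * al 2%nat t / 2 + si 1%nat t).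
{ intros t q; pose proof (dT 2%nat t) as h1; pose proof (dal 1%nat t) as h2.
  pose proof (dsi 0%nat t) as h3.
  apply (is_derive_unique_ext _ _ _ _ _ (heat_derive_t None t q 1) (fun s => hphi s q)).
  auto_derive; [repeat split; eexists; eassumption |].
  rewrite (Derive_of _ _ _ h1), (Derive_of _ _ _ h2), (Derive_of _ _ _ h3); field. }
assert (hphiqq : forall t q, jet2 v (point_tq t q 1) qq qq None = T 2%nat t / 4).
{ intros t q; unfold jet2; apply is_derive_unique.
  apply (is_derive_ext (fun s => s * T 2%nat t / 4 + al 1%nat t / 2)).
  - intros s; rewrite upd_tq_q; symmetry; apply hphiq.
  - auto_derive; [trivial | simpl; field]. }
(* The equation phi_t + phi_qq = 0 is quadratic in q, so the points 0, 1, -1 isolate its three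
   coefficients. *)
assert (hode : forall t, T 3%nat t = 0 /\ al 2%nat t = 0 /\ si 1%nat t = - T 2%nat t / 4).
{ intros t.
  assert (h : forall q, q ^ 2 * T 3%nat t / 8 + q * al 2%nat t / 2 + si 1%nat t
    + T 2%nat t / 4 = 0).
  { intros q; rewrite <- hphit, <- (hphiqq t q).
    now apply heat_phi_order_two. }
  pose proof (h 0); pose proof (h 1); pose proof (h (-1)); lra. }
assert (cst : forall F, (forall s : R, is_derive F s 0) -> forall t, F t = F 0).
{ intros F h t; apply (derive_zero_const (fun _ => True) F); auto. }
assert (hT2 : forall t, T 2%nat t = T 2%nat 0).
{ apply cst; intros s; rewrite <- (proj1 (hode s)); apply dT. }
assert (hal1 : forall t, al 1%nat t = al 1%nat 0).
{ apply cst; intros s; rewrite <- (proj1 (proj2 (hode s))); apply dal. }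
assert (int : forall F dF G, (forall s : R, is_derive F s (dF s)) ->
  (forall s : R, is_derive G s (dF s)) -> forall t, F t = F 0 + G t - G 0).
{ intros F dF G hF hG t.
  assert (e := same_derive (fun _ => True) F G dF); simpl in e.
  enough (F t - F 0 = G t - G 0) by lra; apply e; auto. }
assert (hT1 : forall t, T 1%nat t = T 1%nat 0 + t * T 2%nat 0).
{ intros t; rewrite (int (T 1%nat) (fun _ => T 2%nat 0) (fun t => t * T 2%nat 0)); [ring | |];
    intros s; [rewrite <- (hT2 s); apply dT | auto_derive; [trivial | ring]]. }
assert (hT0 : forall t, T 0%nat t = T 0%nat 0 + t * T 1%nat 0 + t ^ 2 / 2 * T 2%nat 0).
{ intros t; rewrite (int (T 0%nat) (fun t => T 1%nat 0 + t * T 2%nat 0)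
    (fun t => t * T 1%nat 0 + t ^ 2 / 2 * T 2%nat 0)); [field | |];
    intros s; [rewrite <- (hT1 s); apply dT | auto_derive; [trivial | field]]. }
assert (hal0 : forall t, al 0%nat t = al 0%nat 0 + t * al 1%nat 0).
{ intros t; rewrite (int (al 0%nat) (fun _ => al 1%nat 0) (fun t => t * al 1%nat 0)); [ring | |];
    intros s; [rewrite <- (hal1 s); apply dal | auto_derive; [trivial | ring]]. }
assert (hsi0 : forall t, si 0%nat t = si 0%nat 0 - t * T 2%nat 0 / 4).
{ intros t; rewrite (int (si 0%nat) (fun _ => - T 2%nat 0 / 4) (fun t => - t * T 2%nat 0 / 4));
    [field | |]; intros s; [| auto_derive; [trivial | field]].
  rewrite <- (hT2 s), <- (proj2 (proj2 (hode s))); apply dsi. }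
(* The parameters are read off from [heat_term] at t = q = 0 and from the t-derivatives there; the
   summand T'(0)/2 in M_Z undoes the contribution -M_H/2 to the u-coefficient. *)
exists (fun i => match i with
  | M_E => T 2%nat 0 / 2 | M_F => - T 0%nat 0 | M_H => T 1%nat 0 / 2
  | M_X => al 1%nat 0 | M_Y => - al 0%nat 0 | M_Z => 2 * si 0%nat 0 + T 1%nat 0 / 2 end).
apply functional_extensionality; intros z; apply functional_extensionality; intros k.
unfold heat_field; rewrite term_vfieldE by trivial.
rewrite (point_tq_eta z); generalize (z tt) (z qq) (z None); clear z; intros t q u.
destruct (heat_at_one t q u) as [e1 [e2 e3]].
destruct k as [[] |]; [rewrite e1, <- hT, (hT0 t)
  | rewrite e2, hxi, (hT1 t), (hal0 t)
  | rewrite e3, hphi, (hT2 t), (hal1 t), (hsi0 t)]; simpl; field.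
Qed.
End HeatClassification.

(** * Classification for the two-factor equation *)

Definition point (x y t u : R) : option xyt -> R :=
  fun k => match k with Some x_ => x | Some y_ => y | Some t_ => t | None => u end.

Lemma pointE z : z = point (z (Some x_)) (z (Some y_)) (z (Some t_)) (z None).
Proof. now apply functional_extensionality; intros [[] |]. Qed.

Lemma upd_point_x x y t u s : upd (point x y t u) (Some x_) s = point s y t u.
Proof. now apply functional_extensionality; intros [[] |]. Qed.
Lemma upd_point_y x y t u s : upd (point x y t u) (Some y_) s = point x s t u.
Proof. now apply functional_extensionality; intros [[] |]. Qed.
Lemma upd_point_t x y t u s : upd (point x y t u) (Some t_) s = point x y s u.
Proof. now apply functional_extensionality; intros [[] |]. Qed.
Lemma upd_point_u x y t u s : upd (point x y t u) None s = point x y t s.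
Proof. now apply functional_extensionality; intros [[] |]. Qed.

Lemma quadrant_upd_convex z j a b s : quadrant (upd z j a) -> quadrant (upd z j b) ->
  a <= s <= b -> quadrant (upd z j s).
Proof.
unfold quadrant, upd; simpl; destruct j as [[] |]; simpl; intuition lra.
Qed.

Section Classification.
Variables (b d : R) (v : vfield (option xyt)).
Hypothesis sv : lie_car (L_alg (1 / 4) b d b) v.

Local Notation comp k := (fun z => v z k).
Local Notation X := (Some x_).
Local Notation Y := (Some y_).
Local Notation T := (Some t_).

Lemma two_factor_smooth n k : class_C n quadrant (comp k).
Proof. apply sv. Qed.

Lemma two_factor_smooth1 n j k : class_C n quadrant (pd j (comp k)).
Proof. destruct (two_factor_smooth (S n) k) as [_ h]; apply h. Qed.

Lemma two_factor_la : exists la : (xyt -> R) -> R,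
  forall z, quadrant z -> v z None = la (indep z) * z None.
Proof.
destruct (proj2 sv) as [la [mu [h1 h2]]]; exists la; intros z hz.
rewrite h1, h2 by trivial; apply Rplus_0_r.
Qed.

(** The equation is solved for u_t, leaving u_x, u_y, u_xx, u_yy and, as w, m, n below, u_xy, u_xt,
    u_yt free. *)
Definition two_factor_p (z : option xyt -> R) (p1 p2 q1 q2 : R) (i : xyt) : R :=
  match i with x_ => p1 | y_ => p2
  | t_ => - ((1 / 4 - b * z X) * p1 + (d - b * z Y) * p2 + z X / 2 * q1 + z Y / 2 * q2) end.

Definition two_factor_q (q1 q2 w m n : R) (i j : xyt) : R :=
  match i, j with
  | x_, x_ => q1 | y_, y_ => q2 | t_, t_ => 0
  | x_, y_ | y_, x_ => w | x_, t_ | t_, x_ => m | y_, t_ | t_, y_ => n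
  end.

Lemma two_factor_eq z p1 p2 q1 q2 w m n : quadrant z ->
  let p := two_factor_p z p1 p2 q1 q2 in let q := two_factor_q q1 q2 w m n in
  - b * v z X * p x_
  + (1 / 4 - b * z X) * prolong1_jet (jet1 v z) x_ p
  - b * v z Y * p y_
  + (d - b * z Y) * prolong1_jet (jet1 v z) y_ p
  + v z X / 2 * q x_ x_ + z X / 2 * prolong2_jet (jet1 v z) (jet2 v z) x_ p q
  + v z Y / 2 * q y_ y_ + z Y / 2 * prolong2_jet (jet1 v z) (jet2 v z) y_ p q
  + prolong1_jet (jet1 v z) t_ p = 0.
Proof.
intros hz p q; rewrite <- (pr2_two_factor _ _ _ _ quadrant) by (apply sv || trivial).
apply sv; trivial; [now intros [] [] |].
unfold Delta_two_factor, p, q; cbn; ring.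
Qed.

Ltac two_factor_coef z hz l :=
  let H := fresh in
  pose proof (fun p1 p2 q1 q2 w m n => two_factor_eq z p1 p2 q1 q2 w m n hz) as H;
  unfold prolong1_jet, prolong2_jet, isum, kron in H; cbn in H;
  let rec go l := lazymatch l with
    | nil => idtac
    | cons (?p1, ?p2, ?q1, ?q2, ?w, ?m, ?n) ?l' => pose proof (H p1 p2 q1 q2 w m n); go l'
    end in go l; clear H.

Lemma mul_pos_zero x r : 0 < x -> x * r = 0 -> r = 0.
Proof. intros hx h; apply Rmult_integral in h; lra. Qed.

(** The coefficients of u_xt and u_yt are -x (tau_x + u_x tau_u) and -y (tau_y + u_y tau_u);
    positivity of x and y allows the division. *)
Lemma two_factor_tau_first_order z : quadrant z ->
  jet1 v z X T = 0 /\ jet1 v z Y T = 0 /\ jet1 v z None T = 0.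
Proof.
intros hz.
assert (h1 : z X * jet1 v z X T = 0)
  by (two_factor_coef z hz [(0, 0, 0, 0, 0, 0, 0); (0, 0, 0, 0, 0, 1, 0)]; lra).
assert (h2 : z Y * jet1 v z Y T = 0)
  by (two_factor_coef z hz [(0, 0, 0, 0, 0, 0, 0); (0, 0, 0, 0, 0, 0, 1)]; lra).
assert (h3 : z X * (jet1 v z X T + jet1 v z None T) = 0)
  by (two_factor_coef z hz [(1, 0, 0, 0, 0, 0, 0); (1, 0, 0, 0, 0, 1, 0)]; lra).
destruct hz as [hx hy].
apply mul_pos_zero in h1; trivial; apply mul_pos_zero in h2; trivial.
apply mul_pos_zero in h3; trivial; lra.
Qed.

Lemma two_factor_tau_second_order z i j : quadrant z -> j <> T -> jet2 v z i j T = 0.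
Proof.
intros hz h; apply (pd_zero_on quadrant); trivial; [apply open_quadrant |].
intros z' hz'; destruct (two_factor_tau_first_order z' hz') as [h1 [h2 h3]].
destruct j as [[] |]; trivial; now contradict h.
Qed.

Ltac tau_zero z hz :=
  let h1 := fresh in let h2 := fresh in let h3 := fresh in
  destruct (two_factor_tau_first_order z hz) as [h1 [h2 h3]];
  rewrite ?h1, ?h2, ?h3,
    ?(fun i => two_factor_tau_second_order z i X hz),
    ?(fun i => two_factor_tau_second_order z i Y hz),
    ?(fun i => two_factor_tau_second_order z i None hz) in * by discriminate.

(** All three come from the coefficient of u_xy, which is -(x D_x gamma + y D_y xi): its parts free
    of u_x and u_y, linear in u_x, and linear in u_y. *)
Lemma two_factor_xi_first_order z : quadrant z -> jet1 v z None X = 0 /\ jet1 v z None Y = 0 /\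
  z X * jet1 v z X Y + z Y * jet1 v z Y X = 0.
Proof.
intros hz.
assert (h1 : z X * jet1 v z X Y + z Y * jet1 v z Y X = 0)
  by (two_factor_coef z hz [(0, 0, 0, 0, 0, 0, 0); (0, 0, 0, 0, 1, 0, 0)]; tau_zero z hz; lra).
assert (h2 : z X * jet1 v z None Y = 0)
  by (two_factor_coef z hz [(1, 0, 0, 0, 0, 0, 0); (1, 0, 0, 0, 1, 0, 0)]; tau_zero z hz; lra).
assert (h3 : z Y * jet1 v z None X = 0)
  by (two_factor_coef z hz [(0, 1, 0, 0, 0, 0, 0); (0, 1, 0, 0, 1, 0, 0)]; tau_zero z hz; lra).
destruct hz as [hx hy].
apply mul_pos_zero in h2; trivial; apply mul_pos_zero in h3; trivial; lra.
Qed.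

Lemma two_factor_xi_second_order z i : quadrant z -> jet2 v z i None X = 0 /\ jet2 v z i None Y = 0.
Proof.
intros hz; split; (apply (pd_zero_on quadrant); trivial; [apply open_quadrant |]);
  intros z' hz'; now apply two_factor_xi_first_order.
Qed.

Ltac xi_zero z hz :=
  let h1 := fresh in let h2 := fresh in
  destruct (two_factor_xi_first_order z hz) as [h1 [h2 _]];
  rewrite ?h1, ?h2,
    ?(fun i => proj1 (two_factor_xi_second_order z i hz)),
    ?(fun i => proj2 (two_factor_xi_second_order z i hz)) in *.

(** These are the coefficients of u_xx and u_yy; the halves come from the factors x and y in front
    of the second derivatives. *)
Lemma two_factor_scaling z : quadrant z ->
  z X * jet1 v z X X = v z X / 2 + z X / 2 * jet1 v z T T /\
  z Y * jet1 v z Y Y = v z Y / 2 + z Y / 2 * jet1 v z T T.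
Proof.
intros hz; split.
- two_factor_coef z hz [(0, 0, 0, 0, 0, 0, 0); (0, 0, 1, 0, 0, 0, 0)].
  tau_zero z hz; xi_zero z hz; lra.
- two_factor_coef z hz [(0, 0, 0, 0, 0, 0, 0); (0, 0, 0, 1, 0, 0, 0)].
  tau_zero z hz; xi_zero z hz; lra.
Qed.

Lemma two_factor_phi_equations z : quadrant z -> z None = 1 ->
  z X * jet1 v z X None =
    b * v z X + (1 / 4 - b * z X) * jet1 v z X X + z X / 2 * jet2 v z X X X
    + (d - b * z Y) * jet1 v z Y X + z Y / 2 * jet2 v z Y Y X + jet1 v z T X
    - (1 / 4 - b * z X) * jet1 v z T T /\
  z Y * jet1 v z Y None =
    b * v z Y + (1 / 4 - b * z X) * jet1 v z X Y + z X / 2 * jet2 v z X X Y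
    + (d - b * z Y) * jet1 v z Y Y + z Y / 2 * jet2 v z Y Y Y + jet1 v z T Y
    - (d - b * z Y) * jet1 v z T T /\
  (1 / 4 - b * z X) * jet1 v z X None + (d - b * z Y) * jet1 v z Y None
    + z X / 2 * jet2 v z X X None + z Y / 2 * jet2 v z Y Y None + jet1 v z T None = 0.
Proof.
intros hz h1; destruct two_factor_la as [la hla].
assert (cD : forall z s, quadrant z -> quadrant (upd z None s)) by (intros z' s h; exact h).
assert (e1 : forall i, jet2 v z (Some i) None None = jet1 v z (Some i) None)
  by (intros i; apply (pd_i_u_phi quadrant _ la); auto using open_quadrant).
assert (e2 : forall i, jet2 v z None (Some i) None = jet1 v z (Some i) None)
  by (intros i; apply (pd_u_i_phi quadrant _ la); auto using open_quadrant).
repeat split.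
(* The values 1, -1, 2, -2 of u_x single out the linear term among the powers of u_x; the next case
   does the same with u_y. *)
- two_factor_coef z hz [(1, 0, 0, 0, 0, 0, 0); (-1, 0, 0, 0, 0, 0, 0);
    (2, 0, 0, 0, 0, 0, 0); (-2, 0, 0, 0, 0, 0, 0)].
  tau_zero z hz; xi_zero z hz; rewrite ?e1, ?e2 in *; lra.
- two_factor_coef z hz [(0, 1, 0, 0, 0, 0, 0); (0, -1, 0, 0, 0, 0, 0);
    (0, 2, 0, 0, 0, 0, 0); (0, -2, 0, 0, 0, 0, 0)].
  tau_zero z hz; xi_zero z hz; rewrite ?e1, ?e2 in *; lra.
- two_factor_coef z hz [(0, 0, 0, 0, 0, 0, 0)].
  tau_zero z hz; xi_zero z hz; rewrite ?e1, ?e2 in *; lra.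
Qed.
Lemma two_factor_derive_x j k x y t u : 0 < x -> 0 < y ->
  is_derive (fun s => v (point s y t u) k) x (jet1 v (point x y t u) X k) /\
  is_derive (fun s => jet1 v (point s y t u) j k) x (jet2 v (point x y t u) X j k).
Proof.
intros hx hy; split;
[generalize (is_derive_line quadrant (comp k) (point 0 y t u) X x (two_factor_smooth 1 k))
| generalize (is_derive_line quadrant (pd j (comp k)) (point 0 y t u) X x
    (two_factor_smooth1 1 j k))];
rewrite upd_point_x; intros h; generalize (h (conj hx hy));
apply is_derive_ext; intros s; now rewrite upd_point_x.
Qed.

Lemma two_factor_derive_y j k x y t u : 0 < x -> 0 < y ->
  is_derive (fun s => v (point x s t u) k) y (jet1 v (point x y t u) Y k) /\
  is_derive (fun s => jet1 v (point x s t u) j k) y (jet2 v (point x y t u) Y j k).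
Proof.
intros hx hy; split;
[generalize (is_derive_line quadrant (comp k) (point x 0 t u) Y y (two_factor_smooth 1 k))
| generalize (is_derive_line quadrant (pd j (comp k)) (point x 0 t u) Y y
    (two_factor_smooth1 1 j k))];
rewrite upd_point_y; intros h; generalize (h (conj hx hy));
apply is_derive_ext; intros s; now rewrite upd_point_y.
Qed.

Lemma two_factor_derive_t k x y t u : 0 < x -> 0 < y ->
  is_derive (fun s => v (point x y s u) k) t (jet1 v (point x y t u) T k).
Proof.
intros hx hy.
generalize (is_derive_line quadrant (comp k) (point x y 0 u) T t (two_factor_smooth 1 k)).
rewrite upd_point_t; intros h; generalize (h (conj hx hy));
apply is_derive_ext; intros s; now rewrite upd_point_t.
Qed.

Lemma two_factor_at_one x y t u : 0 < x -> 0 < y -> v (point x y t u) T = v (point 1 1 t 1) T /\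
  v (point x y t u) X = v (point x y t 1) X /\
  v (point x y t u) Y = v (point x y t 1) Y /\
  v (point x y t u) None = v (point x y t 1) None * u.
Proof.
intros hx hy.
assert (hu : forall k, (forall z, quadrant z -> pd None (comp k) z = 0) ->
  v (point x y t u) k = v (point x y t 1) k).
{ intros k h; rewrite <- (upd_point_u x y t 1 u).
  rewrite <- (upd_point_u x y t 1 1) at 2.
  apply (pd_zero_const quadrant (comp k));
    first [now split | apply two_factor_smooth | exact h]. }
repeat split.
- rewrite hu by (intros z hz; now apply two_factor_tau_first_order).
  transitivity (v (point 1 y t 1) T).
  + rewrite <- (upd_point_x 1 y t 1 x); rewrite <- (upd_point_x 1 y t 1 1) at 2.
    apply (pd_zero_const quadrant (comp T)); trivial;
      [intros r s r'; apply quadrant_upd_convex | apply two_factor_smooth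
      | intros z hz; now apply two_factor_tau_first_order | now split
      | split; trivial; apply Rlt_0_1].
  + rewrite <- (upd_point_y 1 1 t 1 y); rewrite <- (upd_point_y 1 1 t 1 1) at 2.
    apply (pd_zero_const quadrant (comp T)); trivial;
      [intros r s r'; apply quadrant_upd_convex | apply two_factor_smooth
      | intros z hz; now apply two_factor_tau_first_order | split | split]; trivial; apply Rlt_0_1.
- apply hu; intros z hz; now apply two_factor_xi_first_order.
- apply hu; intros z hz; now apply two_factor_xi_first_order.
- destruct two_factor_la as [la hla]; rewrite !hla by now split.
  rewrite <- (upd_point_u x y t 1 u), indep_upd; simpl; unfold upd; simpl; ring.
Qed.

Lemma two_factor_smooth_t (f : (option xyt -> R) -> R) : (forall n, class_C n quadrant f) ->
  exists F : nat -> R -> R,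
  (forall s, F O s = f (point 1 1 s 1)) /\ forall n s, is_derive (F n) s (F (S n) s).
Proof.
intros hf; destruct (smooth_line quadrant f (point 1 1 0 1) T hf) as [F [h1 h2]];
  [intros s; split; apply Rlt_0_1 |].
exists F; split; trivial; intros s; now rewrite h1, upd_point_t.
Qed.

End Classification.

Lemma open_positive : open (fun s : R => 0 < s).
Proof. apply open_gt. Qed.

Lemma is_derive_affine (f : R -> R) x l a c e : is_derive f x l ->
  is_derive (fun s => a + c * (f s - e)) x (c * l).
Proof.
intros h; auto_derive; [repeat split; eexists; eassumption |].
rewrite (Derive_of _ _ _ h); ring.
Qed.

(* [ring] needs the type of an equality to be [R] itself, not a structure on it. *)
Ltac real_eq := match goal with |- ?x = ?y => change (@eq R x y) end.

(** * Integration of the x- and y-coefficients *)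

Section Integration.
Variables (b d : R) (v : vfield (option xyt)).
Hypothesis sv : lie_car (L_alg (1 / 4) b d b) v.

Local Notation X := (Some x_).
Local Notation Y := (Some y_).
Local Notation T := (Some t_).
Local Notation D1x j k x y t hx hy := (proj1 (two_factor_derive_x b d v sv j k x y t 1 hx hy)).
Local Notation D1y j k x y t hx hy := (proj1 (two_factor_derive_y b d v sv j k x y t 1 hx hy)).

(** [scaling_solution] fixes the x-dependence of xi and the y-dependence of gamma. Then xi_y and
    gamma_x scale like sqrt x and sqrt y, so that x gamma_x + y xi_y = 0 separates: on the lines x =
    1 and y = 1 both are determined by the number k(t) = gamma_x(1, 1, t). *)
Lemma two_factor_structure : exists ta al be ka : nat -> R -> R,
  (forall n s, is_derive (ta n) s (ta (S n) s)) /\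
  (forall n s, is_derive (al n) s (al (S n) s)) /\
  (forall n s, is_derive (be n) s (be (S n) s)) /\
  (forall n s, is_derive (ka n) s (ka (S n) s)) /\
  forall x y t, 0 < x -> 0 < y ->
    v (point x y t 1) T = ta 0%nat t /\
    v (point x y t 1) X = x * ta 1%nat t + sqrt x * (al 0%nat t - ka 0%nat t * sqrt y) /\
    v (point x y t 1) Y = y * ta 1%nat t + sqrt y * (be 0%nat t + ka 0%nat t * sqrt x).
Proof.
destruct (two_factor_smooth_t (fun z => v z T)) as [ta [hta dta]];
  [intros n; apply (two_factor_smooth b d v sv) |].
destruct (two_factor_smooth_t (fun z => v z X)) as [xi [hxi dxi]];
  [intros n; apply (two_factor_smooth b d v sv) |].
destruct (two_factor_smooth_t (fun z => v z Y)) as [ga [hga dga]];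
  [intros n; apply (two_factor_smooth b d v sv) |].
destruct (two_factor_smooth_t (pd X (fun z => v z Y))) as [k [hk dk]];
  [intros n; apply (two_factor_smooth1 b d v sv) |].
assert (p1 := Rlt_0_1).
assert (hT : forall x y t, 0 < x -> 0 < y -> v (point x y t 1) T = ta 0%nat t).
{ intros x y t hx hy; rewrite hta; now apply (two_factor_at_one b d v sv). }
assert (hTT : forall x y t, 0 < x -> 0 < y -> jet1 v (point x y t 1) T T = ta 1%nat t).
{ intros x y t hx hy; apply (is_derive_unique_ext _ (ta 0%nat) _ _ _
    (two_factor_derive_t b d v sv T x y t 1 hx hy)); auto. }
assert (hX : forall x y t, 0 < x -> 0 < y -> v (point x y t 1) X =
  x * ta 1%nat t + sqrt x * (v (point 1 y t 1) X - ta 1%nat t)).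
{ intros x y t hx hy; apply (scaling_solution (fun s => v (point s y t 1) X)
    (fun s => jet1 v (point s y t 1) X X)); trivial.
  - intros s hs; exact (D1x X X s y t hs hy).
  - intros s hs; rewrite <- (hTT s y t) by trivial.
    exact (proj1 (two_factor_scaling b d v sv (point s y t 1) (conj hs hy))). }
assert (hY : forall x y t, 0 < x -> 0 < y -> v (point x y t 1) Y =
  y * ta 1%nat t + sqrt y * (v (point x 1 t 1) Y - ta 1%nat t)).
{ intros x y t hx hy; apply (scaling_solution (fun s => v (point x s t 1) Y)
    (fun s => jet1 v (point x s t 1) Y Y)); trivial.
  - intros s hs; exact (D1y X Y x s t hx hs).
  - intros s hs; rewrite <- (hTT x s t) by trivial.
    exact (proj2 (two_factor_scaling b d v sv (point x s t 1) (conj hx hs))). }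
assert (hXy : forall x y t, 0 < x -> 0 < y ->
  jet1 v (point x y t 1) Y X = sqrt x * jet1 v (point 1 y t 1) Y X).
{ intros x y t hx hy.
  apply (is_derive_unique_loc _ _ _ _ _ _ open_positive hy (D1y X X x y t hx hy)
    (fun s hs => hX x s t hx hs)).
  apply (is_derive_affine (fun s => v (point 1 s t 1) X)); exact (D1y X X 1 y t p1 hy). }
assert (hYx : forall x y t, 0 < x -> 0 < y ->
  jet1 v (point x y t 1) X Y = sqrt y * jet1 v (point x 1 t 1) X Y).
{ intros x y t hx hy.
  apply (is_derive_unique_loc _ _ _ _ _ _ open_positive hx (D1x X Y x y t hx hy)
    (fun s hs => hY s y t hs hy)).
  apply (is_derive_affine (fun s => v (point s 1 t 1) Y)); exact (D1x X Y x 1 t hx p1). }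
assert (rot : forall x y t, 0 < x -> 0 < y ->
  x * jet1 v (point x y t 1) X Y + y * jet1 v (point x y t 1) Y X = 0).
{ intros x y t hx hy;
  exact (proj2 (proj2 (two_factor_xi_first_order b d v sv (point x y t 1) (conj hx hy)))). }
assert (hk' : forall t, k 0%nat t = jet1 v (point 1 1 t 1) X Y) by (intros t; apply hk).
assert (hX1y : forall y t, 0 < y -> jet1 v (point 1 y t 1) Y X = - k 0%nat t / sqrt y).
{ intros y t hy; assert (h := rot 1 y t p1 hy); rewrite hYx, <- hk' in h by trivial.
  destruct (sqrt_pos_eq y hy) as [r [hr [e1 e2]]]; rewrite e2 in *.
  apply (Rmult_eq_reg_l y); [| lra].
  replace (y * jet1 v (point 1 y t 1) Y X) with (- (r * k 0%nat t)) by lra.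
  rewrite e1; field; lra. }
assert (hYx1 : forall x t, 0 < x -> jet1 v (point x 1 t 1) X Y = k 0%nat t / sqrt x).
{ intros x t hx; assert (h := rot x 1 t hx p1); rewrite hXy, hX1y, sqrt_1 in h by trivial.
  destruct (sqrt_pos_eq x hx) as [r [hr [e1 e2]]]; rewrite e2 in *.
  apply (Rmult_eq_reg_l x); [| lra].
  replace (x * jet1 v (point x 1 t 1) X Y) with (r * k 0%nat t) by lra.
  rewrite e1; field; lra. }
assert (iX : forall y t, 0 < y -> v (point 1 y t 1) X = xi 0%nat t - 2 * k 0%nat t * (sqrt y - 1)).
{ intros y t hy.
  assert (e := same_derive _ (fun s => v (point 1 s t 1) X) (fun s => - 2 * k 0%nat t * sqrt s)
    (fun s => - k 0%nat t / sqrt s) positive_convex); simpl in e.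
  enough (v (point 1 y t 1) X - v (point 1 1 t 1) X
    = - 2 * k 0%nat t * sqrt y - - 2 * k 0%nat t * sqrt 1) as h
    by (rewrite hxi; rewrite sqrt_1 in h; lra).
  apply e; trivial.
  - intros s hs; rewrite <- hX1y by trivial; exact (D1y X X 1 s t p1 hs).
  - intros s hs; assert (hr := sqrt_lt_R0 _ hs); auto_derive; [trivial | field; lra]. }
assert (iY : forall x t, 0 < x -> v (point x 1 t 1) Y = ga 0%nat t + 2 * k 0%nat t * (sqrt x - 1)).
{ intros x t hx.
  assert (e := same_derive _ (fun s => v (point s 1 t 1) Y) (fun s => 2 * k 0%nat t * sqrt s)
    (fun s => k 0%nat t / sqrt s) positive_convex); simpl in e.
  enough (v (point x 1 t 1) Y - v (point 1 1 t 1) Y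
    = 2 * k 0%nat t * sqrt x - 2 * k 0%nat t * sqrt 1) as h
    by (rewrite hga; rewrite sqrt_1 in h; lra).
  apply e; trivial.
  - intros s hs; rewrite <- hYx1 by trivial; exact (D1x X Y s 1 t hs p1).
  - intros s hs; assert (hr := sqrt_lt_R0 _ hs); auto_derive; [trivial | field; lra]. }
(* Integrating k / sqrt gives 2 k (sqrt - 1). Hence kappa = 2 k, and the lower limit 1 puts +2 k
   into alpha and -2 k into beta. *)
exists ta, (fun n s => xi n s - ta (S n) s + 2 * k n s),
  (fun n s => ga n s - ta (S n) s - 2 * k n s), (fun n s => 2 * k n s).
split; [exact dta |].
split; [| split; [| split]];
  try (intros n s; pose proof (dta (S n) s) as h1; pose proof (dxi n s) as h2;
    pose proof (dga n s) as h3; pose proof (dk n s) as h4;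
    auto_derive; [repeat split; eexists; eassumption |];
    rewrite ?(Derive_of _ _ _ h1), ?(Derive_of _ _ _ h2), ?(Derive_of _ _ _ h3),
      ?(Derive_of _ _ _ h4); ring).
intros x y t hx hy; split; [auto | split].
- rewrite hX, iX by trivial; real_eq; ring.
- rewrite hY, iY by trivial; real_eq; ring.
Qed.
End Integration.

(** * The u-coefficient and the vanishing of the y-part *)

Section UCoefficient.
Variables (b d : R) (v : vfield (option xyt)).
Hypothesis sv : lie_car (L_alg (1 / 4) b d b) v.
Hypotheses (b0 : b <> 0) (d1 : d <> 1 / 4) (d3 : d <> 3 / 4).
Variables ta al be ka la : nat -> R -> R.
Hypothesis dta : forall n s, is_derive (ta n) s (ta (S n) s).
Hypothesis dal : forall n s, is_derive (al n) s (al (S n) s).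
Hypothesis dbe : forall n s, is_derive (be n) s (be (S n) s).
Hypothesis dka : forall n s, is_derive (ka n) s (ka (S n) s).
Hypothesis dla : forall n s, is_derive (la n) s (la (S n) s).

Local Notation X := (Some x_).
Local Notation Y := (Some y_).
Local Notation T := (Some t_).
Local Notation dx j k x y t hx hy := (two_factor_derive_x b d v sv j k x y t 1 hx hy).
Local Notation dy j k x y t hx hy := (two_factor_derive_y b d v sv j k x y t 1 hx hy).

Hypothesis hv : forall x y t, 0 < x -> 0 < y ->
    v (point x y t 1) T = ta 0%nat t /\
    v (point x y t 1) X = x * ta 1%nat t + sqrt x * (al 0%nat t - ka 0%nat t * sqrt y) /\
    v (point x y t 1) Y = y * ta 1%nat t + sqrt y * (be 0%nat t + ka 0%nat t * sqrt x).

Hypothesis hla : forall t, v (point 1 1 t 1) None = la 0%nat t.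

Let hT x y t hx hy := proj1 (hv x y t hx hy).
Let hX x y t hx hy := proj1 (proj2 (hv x y t hx hy)).
Let hY x y t hx hy := proj2 (proj2 (hv x y t hx hy)).

Ltac jet_by hs hd hf :=
  apply (is_derive_unique_loc _ _ _ _ _ _ open_positive hs hd hf);
  auto_derive; [repeat split; trivial | field; lra].

Lemma two_factor_jets x y t : 0 < x -> 0 < y ->
  jet1 v (point x y t 1) X X = ta 1%nat t + (al 0%nat t - ka 0%nat t * sqrt y) / (2 * sqrt x) /\
  jet1 v (point x y t 1) Y X = - ka 0%nat t * sqrt x / (2 * sqrt y) /\
  jet1 v (point x y t 1) X Y = ka 0%nat t * sqrt y / (2 * sqrt x) /\
  jet1 v (point x y t 1) Y Y = ta 1%nat t + (be 0%nat t + ka 0%nat t * sqrt x) / (2 * sqrt y).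
Proof.
intros hx hy; assert (hr := sqrt_lt_R0 _ hx); assert (hs := sqrt_lt_R0 _ hy).
repeat split.
- jet_by hx (proj1 (dx X X x y t hx hy)) (fun s hs => hX s y t hs hy).
- jet_by hy (proj1 (dy X X x y t hx hy)) (fun s hs => hX x s t hx hs).
- jet_by hx (proj1 (dx X Y x y t hx hy)) (fun s hs => hY s y t hs hy).
- jet_by hy (proj1 (dy X Y x y t hx hy)) (fun s hs => hY x s t hx hs).
Qed.

Lemma two_factor_jets2 x y t : 0 < x -> 0 < y ->
  jet2 v (point x y t 1) X X X = - (al 0%nat t - ka 0%nat t * sqrt y) / (4 * sqrt x ^ 3) /\
  jet2 v (point x y t 1) Y Y X = ka 0%nat t * sqrt x / (4 * sqrt y ^ 3) /\
  jet2 v (point x y t 1) X X Y = - ka 0%nat t * sqrt y / (4 * sqrt x ^ 3) /\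
  jet2 v (point x y t 1) Y Y Y = - (be 0%nat t + ka 0%nat t * sqrt x) / (4 * sqrt y ^ 3).
Proof.
intros hx hy; assert (hr := sqrt_lt_R0 _ hx); assert (hs := sqrt_lt_R0 _ hy).
repeat split.
- apply (is_derive_unique_loc _ _ _ _ _ _ open_positive hx (proj2 (dx X X x y t hx hy))
    (fun s hs => proj1 (two_factor_jets s y t hs hy))).
  auto_derive; [repeat split; trivial; lra | field; lra].
- apply (is_derive_unique_loc _ _ _ _ _ _ open_positive hy (proj2 (dy Y X x y t hx hy))
    (fun s hs => proj1 (proj2 (two_factor_jets x s t hx hs)))).
  auto_derive; [repeat split; trivial; lra | field; lra].
- apply (is_derive_unique_loc _ _ _ _ _ _ open_positive hx (proj2 (dx X Y x y t hx hy))
    (fun s hs => proj1 (proj2 (proj2 (two_factor_jets s y t hs hy))))).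
  auto_derive; [repeat split; trivial; lra | field; lra].
- apply (is_derive_unique_loc _ _ _ _ _ _ open_positive hy (proj2 (dy Y Y x y t hx hy))
    (fun s hs => proj2 (proj2 (proj2 (two_factor_jets x s t hx hs))))).
  auto_derive; [repeat split; trivial; lra | field; lra].
Qed.

Lemma two_factor_jets_t x y t : 0 < x -> 0 < y ->
  jet1 v (point x y t 1) T T = ta 1%nat t /\
  jet1 v (point x y t 1) T X =
    x * ta 2%nat t + sqrt x * (al 1%nat t - ka 1%nat t * sqrt y) /\
  jet1 v (point x y t 1) T Y =
    y * ta 2%nat t + sqrt y * (be 1%nat t + ka 1%nat t * sqrt x).
Proof.
intros hx hy.
pose proof (dta 1%nat t) as h1; pose proof (dal 0%nat t) as h2.
pose proof (dbe 0%nat t) as h3; pose proof (dka 0%nat t) as h4.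
repeat split.
- apply (is_derive_unique_ext _ _ _ _ _ (two_factor_derive_t b d v sv T x y t 1 hx hy)
    (fun s => hT x y s hx hy)); apply dta.
- apply (is_derive_unique_ext _ _ _ _ _ (two_factor_derive_t b d v sv X x y t 1 hx hy)
    (fun s => hX x y s hx hy)).
  auto_derive; [repeat split; eexists; eassumption |].
  rewrite (Derive_of _ _ _ h1), (Derive_of _ _ _ h2), (Derive_of _ _ _ h4); ring.
- apply (is_derive_unique_ext _ _ _ _ _ (two_factor_derive_t b d v sv Y x y t 1 hx hy)
    (fun s => hY x y s hx hy)).
  auto_derive; [repeat split; eexists; eassumption |].
  rewrite (Derive_of _ _ _ h1), (Derive_of _ _ _ h3), (Derive_of _ _ _ h4); ring.
Qed.

Lemma two_factor_lambda_xy x y t : 0 < x -> 0 < y ->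
  jet1 v (point x y t 1) X None =
    ta 2%nat t + b * ta 1%nat t + (al 1%nat t + b / 2 * al 0%nat t) / sqrt x
    - ka 1%nat t * sqrt y / sqrt x - (d - 1 / 4) * ka 0%nat t / (2 * sqrt x * sqrt y) /\
  jet1 v (point x y t 1) Y None =
    ta 2%nat t + b * ta 1%nat t + (be 1%nat t + b / 2 * be 0%nat t) / sqrt y
    + ka 1%nat t * sqrt x / sqrt y
    + (d - 1 / 4) * (be 0%nat t + ka 0%nat t * sqrt x) / (2 * sqrt y ^ 3).
Proof.
intros hx hy.
destruct (two_factor_phi_equations b d v sv (point x y t 1) (conj hx hy) eq_refl) as [h1 [h2 _]].
destruct (two_factor_jets x y t hx hy) as [e1 [e2 [e3 e4]]].
destruct (two_factor_jets2 x y t hx hy) as [e5 [e6 [e7 e8]]].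
destruct (two_factor_jets_t x y t hx hy) as [e9 [e10 e11]].
rewrite e1, e2, e5, e6, e9, e10, (hX x y t hx hy) in h1.
rewrite e3, e4, e7, e8, e9, e11, (hY x y t hx hy) in h2.
change (point x y t 1 X) with x in *; change (point x y t 1 Y) with y in *.
clear e1 e2 e3 e4 e5 e6 e7 e8 e9 e10 e11.
revert h1 h2; generalize (jet1 v (point x y t 1) X None), (jet1 v (point x y t 1) Y None).
intros lx ly h1 h2.
destruct (sqrt_pos_eq x hx) as [r [hr [-> er]]]; destruct (sqrt_pos_eq y hy) as [s [hs [-> es]]].
rewrite er, es in *; split.
- apply (Rmult_eq_reg_l (r * r)); [rewrite h1; field; lra | lra].
- apply (Rmult_eq_reg_l (s * s)); [rewrite h2; field; lra | lra].
Qed.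

(** Increments are compared instead of lambda_xy and lambda_yx, so that compatibility becomes a
    finite identity around a rectangle and needs no symmetry of second derivatives. *)
Lemma two_factor_lambda_dx x x' y t : 0 < x -> 0 < x' -> 0 < y ->
  let P x := x * (ta 2%nat t + b * ta 1%nat t) + sqrt x * (2 * al 1%nat t + b * al 0%nat t)
    - 2 * ka 1%nat t * sqrt y * sqrt x - (d - 1 / 4) * ka 0%nat t * sqrt x / sqrt y in
  v (point x y t 1) None - v (point x' y t 1) None = P x - P x'.
Proof.
intros hx hx' hy P.
assert (hs := sqrt_lt_R0 _ hy).
apply (same_derive _ (fun s => v (point s y t 1) None) P
  (fun s => jet1 v (point s y t 1) X None) positive_convex); trivial.
- intros s h; exact (proj1 (dx X None s y t h hy)).
- intros s h; rewrite (proj1 (two_factor_lambda_xy s y t h hy)); assert (hr := sqrt_lt_R0 _ h).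
  unfold P; auto_derive; [repeat split; trivial; lra | field; lra].
Qed.

Lemma two_factor_lambda_dy x y y' t : 0 < x -> 0 < y -> 0 < y' ->
  let Q y := y * (ta 2%nat t + b * ta 1%nat t) + sqrt y * (2 * be 1%nat t + b * be 0%nat t)
    + 2 * ka 1%nat t * sqrt x * sqrt y
    - (d - 1 / 4) * (be 0%nat t + ka 0%nat t * sqrt x) / sqrt y in
  v (point x y t 1) None - v (point x y' t 1) None = Q y - Q y'.
Proof.
intros hx hy hy' Q.
apply (same_derive _ (fun s => v (point x s t 1) None) Q
  (fun s => jet1 v (point x s t 1) Y None) positive_convex); trivial.
- intros s h; exact (proj1 (dy X None x s t hx h)).
- intros s h; rewrite (proj2 (two_factor_lambda_xy x s t hx h)); assert (hr := sqrt_lt_R0 _ h).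
  unfold Q; auto_derive; [repeat split; trivial; lra | field; lra].
Qed.

(* Around the rectangle with vertices (1, 1) and (4, 4) the increments of lambda
   add up to 4 ka'(t). *)
Lemma two_factor_rotation_constant t : ka 1%nat t = 0.
Proof.
assert (p1 := Rlt_0_1); assert (p4 : 0 < 2 * 2) by lra.
assert (h1 := two_factor_lambda_dx (2 * 2) 1 1 t p4 p1 p1).
assert (h2 := two_factor_lambda_dx (2 * 2) 1 (2 * 2) t p4 p1 p4).
assert (h3 := two_factor_lambda_dy 1 (2 * 2) 1 t p1 p4 p1).
assert (h4 := two_factor_lambda_dy (2 * 2) (2 * 2) 1 t p4 p4 p1).
simpl in h1, h2, h3, h4; rewrite ?sqrt_1, ?sqrt_square in h1, h2, h3, h4 by lra.
lra.
Qed.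

(** Sums the increments along the path from (1, 1) to (1, y) to (x, y), with kappa' = 0. *)
Lemma two_factor_lambda x y t : 0 < x -> 0 < y ->
  v (point x y t 1) None =
  (x + y - 2) * (ta 2%nat t + b * ta 1%nat t)
  + (sqrt x - 1) * (2 * al 1%nat t + b * al 0%nat t)
  + (sqrt y - 1) * (2 * be 1%nat t + b * be 0%nat t)
  - (d - 1 / 4) * ((be 0%nat t + ka 0%nat t * sqrt x) / sqrt y - (be 0%nat t + ka 0%nat t))
  + la 0%nat t.
Proof.
intros hx hy; assert (p1 := Rlt_0_1); assert (hs := sqrt_lt_R0 _ hy).
assert (h1 := two_factor_lambda_dx x 1 y t hx p1 hy).
assert (h2 := two_factor_lambda_dy 1 y 1 t p1 hy p1).
simpl in h1, h2; rewrite sqrt_1, two_factor_rotation_constant in *; rewrite <- hla.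
unfold Rdiv in *; rewrite Rinv_1 in *; lra.
Qed.

(** Sorted by powers of sqrt x and sqrt y. The singular term combines d lambda_y and (y/2)
    lambda_yy, which contribute d/2 - 3/8 = (2 d - 3/2) / 4 times (d - 1/4) (beta + kappa sqrt x) /
    sqrt y ^ 3. *)
Lemma two_factor_pde x y t : 0 < x -> 0 < y ->
  (d - 1 / 4) * (2 * d - 3 / 2) * (be 0%nat t + ka 0%nat t * sqrt x) / (4 * sqrt y ^ 3)
  + x * (ta 3%nat t - b ^ 2 * ta 1%nat t) + sqrt x * (2 * al 2%nat t - b ^ 2 / 2 * al 0%nat t)
  + y * (ta 3%nat t - b ^ 2 * ta 1%nat t) + sqrt y * (2 * be 2%nat t - b ^ 2 / 2 * be 0%nat t)
  + (la 1%nat t - 2 * (ta 3%nat t + b * ta 2%nat t) - (2 * al 2%nat t + b * al 1%nat t)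
     - (2 * be 2%nat t + b * be 1%nat t) + (d - 1 / 4) * be 1%nat t
     + (1 / 4 + d) * (ta 2%nat t + b * ta 1%nat t)) = 0.
Proof.
intros hx hy; assert (hr := sqrt_lt_R0 _ hx); assert (hs := sqrt_lt_R0 _ hy).
destruct (two_factor_phi_equations b d v sv (point x y t 1) (conj hx hy) eq_refl) as [_ [_ h]].
destruct (two_factor_lambda_xy x y t hx hy) as [e1 e2].
assert (e3 : jet2 v (point x y t 1) X X None =
  - (al 1%nat t + b / 2 * al 0%nat t) / (2 * sqrt x ^ 3)
  + (d - 1 / 4) * ka 0%nat t / (4 * sqrt x ^ 3 * sqrt y)).
{ apply (is_derive_unique_loc _ _ _ _ _ _ open_positive hx (proj2 (dx X None x y t hx hy))
    (fun s hs => proj1 (two_factor_lambda_xy s y t hs hy))).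
  rewrite two_factor_rotation_constant.
  auto_derive; [repeat split; trivial; try lra; apply Rgt_not_eq;
    repeat apply Rmult_lt_0_compat; lra | field; lra]. }
assert (e4 : jet2 v (point x y t 1) Y Y None =
  - (be 1%nat t + b / 2 * be 0%nat t) / (2 * sqrt y ^ 3)
  - 3 * (d - 1 / 4) * (be 0%nat t + ka 0%nat t * sqrt x) / (4 * sqrt y ^ 5)).
{ apply (is_derive_unique_loc _ _ _ _ _ _ open_positive hy (proj2 (dy Y None x y t hx hy))
    (fun s hs => proj2 (two_factor_lambda_xy x s t hx hs))).
  rewrite two_factor_rotation_constant.
  auto_derive; [repeat split; trivial; try lra; apply Rgt_not_eq;
    repeat apply Rmult_lt_0_compat; lra | field; lra]. }
assert (e5 : jet1 v (point x y t 1) T None =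
  (x + y - 2) * (ta 3%nat t + b * ta 2%nat t)
  + (sqrt x - 1) * (2 * al 2%nat t + b * al 1%nat t)
  + (sqrt y - 1) * (2 * be 2%nat t + b * be 1%nat t)
  - (d - 1 / 4) * (be 1%nat t / sqrt y - be 1%nat t) + la 1%nat t).
{ apply (is_derive_unique_ext _ _ _ _ _ (two_factor_derive_t b d v sv None x y t 1 hx hy)
    (fun s => two_factor_lambda x y s hx hy)).
  pose proof (dla 0%nat t) as hL; pose proof (dta 2%nat t) as h1; pose proof (dta 1%nat t) as h2.
  pose proof (dal 1%nat t) as h3; pose proof (dal 0%nat t) as h4.
  pose proof (dbe 1%nat t) as h5; pose proof (dbe 0%nat t) as h6.
  pose proof (dka 0%nat t) as h7; rewrite two_factor_rotation_constant in h7.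
  auto_derive; [repeat split; eexists; eassumption |].
  rewrite (Derive_of _ _ _ h1), (Derive_of _ _ _ h2), (Derive_of _ _ _ h3),
    (Derive_of _ _ _ h4), (Derive_of _ _ _ h5), (Derive_of _ _ _ h6),
    (Derive_of _ _ _ h7), (Derive_of _ _ _ hL); field; lra. }
rewrite two_factor_rotation_constant in e1, e2.
rewrite e1, e2, e3, e4, e5 in h.
change (point x y t 1 X) with x in *; change (point x y t 1 Y) with y in *.
clear e1 e2 e3 e4 e5.
destruct (sqrt_pos_eq x hx) as [r [_ [-> er]]]; destruct (sqrt_pos_eq y hy) as [s [_ [-> es]]].
rewrite er, es in *; rewrite <- h; field; lra.
Qed.

Lemma two_factor_y_trivial t : be 0%nat t = 0 /\ ka 0%nat t = 0.
Proof.
assert (hM : (d - 1 / 4) * (2 * d - 3 / 2) <> 0)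
  by (apply Rmult_integral_contrapositive; lra).
assert (h : forall r, 0 < r -> be 0%nat t + ka 0%nat t * r = 0).
{ intros r hr.
  assert (hs : forall s, 0 < s -> _) by
    (intros s hs; exact (two_factor_pde (r * r) (s * s) t (Rmult_lt_0_compat _ _ hr hr)
      (Rmult_lt_0_compat _ _ hs hs))).
  (* For fixed r the equation is a combination of s^(-3), s^2, s and 1, which are linearly
     independent on the four points s = 1, 2, 3, 4. *)
  pose proof (hs 1 ltac:(lra)) as h1; pose proof (hs 2 ltac:(lra)) as h2.
  pose proof (hs 3 ltac:(lra)) as h3; pose proof (hs 4 ltac:(lra)) as h4.
  rewrite !sqrt_square in h1, h2, h3, h4 by lra.
  apply (Rmult_eq_reg_l ((d - 1 / 4) * (2 * d - 3 / 2))); [lra | exact hM]. }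
pose proof (h 1 ltac:(lra)); pose proof (h 2 ltac:(lra)); lra.
Qed.

Lemma two_factor_ode t : ta 3%nat t = b ^ 2 * ta 1%nat t /\ al 2%nat t = (b / 2) ^ 2 * al 0%nat t /\
  la 1%nat t = 2 * (ta 3%nat t + b * ta 2%nat t) + (2 * al 2%nat t + b * al 1%nat t)
    - (1 / 4 + d) * (ta 2%nat t + b * ta 1%nat t).
Proof.
assert (e1 : forall t, be 1%nat t = 0).
{ intros r; apply (is_derive_unique_ext _ (fun _ => 0) r _ _ (dbe 0%nat r));
    [intros s; apply two_factor_y_trivial | apply @is_derive_const]. }
assert (e2 : be 2%nat t = 0).
{ apply (is_derive_unique_ext _ (fun _ => 0) t _ _ (dbe 1%nat t));
    [exact e1 | apply @is_derive_const]. }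
destruct (two_factor_y_trivial t) as [e3 e4].
assert (h : forall r, 0 < r -> _) by
  (intros r hr; exact (two_factor_pde (r * r) 1 t (Rmult_lt_0_compat _ _ hr hr) Rlt_0_1)).
(* With the y-part gone and y = 1, a quadratic polynomial in r = sqrt x remains, and three points
   determine its coefficients. *)
pose proof (h 1 ltac:(lra)) as h1; pose proof (h 2 ltac:(lra)) as h2.
pose proof (h 3 ltac:(lra)) as h3.
rewrite !sqrt_square, ?sqrt_1, e1, e2, e3, e4 in h1, h2, h3 by lra.
repeat split; lra.
Qed.

Lemma two_factor_coefficients : exists A, forall x y t, 0 < x -> 0 < y -> forall k,
  v (point x y t 1) k = eval (two_factor_term b d A k) (point x y t 1).
Proof.
(* C1, C2 are the coefficients of exp(bt), exp(-bt) in tau'; D1, D2 those of exp(bt/2), exp(-bt/2)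
   in alpha. *)
set (C1 := (ta 1%nat 0 + ta 2%nat 0 / b) / 2); set (C2 := (ta 1%nat 0 - ta 2%nat 0 / b) / 2).
set (D1 := (al 0%nat 0 + al 1%nat 0 / (b / 2)) / 2).
set (D2 := (al 0%nat 0 - al 1%nat 0 / (b / 2)) / 2).
set (E := fun t => exp (b / 2 * t)).
assert (E0 : E 0 = 1) by (unfold E; now rewrite Rmult_0_r, exp_0).
assert (hE : forall t, 0 < E t) by (intros t; apply exp_pos).
assert (h1 : forall t, ta 1%nat t = C1 * (E t * E t) + C2 * / (E t * E t)).
{ intros t; replace (E t * E t) with (exp (b * t))
    by (unfold E; rewrite <- exp_plus; f_equal; field).
  apply (exponential_solution _ (ta 2%nat)); [exact b0 | exact (dta 1%nat) |].
  intros s; rewrite <- (proj1 (two_factor_ode s)); apply dta. }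
assert (h2 : forall t, al 0%nat t = D1 * E t + D2 * / E t).
{ intros t; apply (exponential_solution _ (al 1%nat)); [lra | exact (dal 0%nat) |].
  intros s; rewrite <- (proj1 (proj2 (two_factor_ode s))); apply dal. }
assert (dE : forall t, is_derive E t (b / 2 * E t))
  by (intros t; unfold E; auto_derive; [trivial | ring]).
assert (eE : forall t, exp (b / 2 * t) = E t) by reflexivity; clearbody E.
assert (h3 : forall t, ta 2%nat t = b * (C1 * (E t * E t)) - b * (C2 * / (E t * E t))).
{ intros t; apply (is_derive_unique_ext _ _ _ _ _ (dta 1%nat t) h1).
  specialize (hE t); pose proof (dE t) as h; auto_derive;
    [repeat split; try (eexists; eassumption); nra |].
  rewrite (Derive_of _ _ _ h); field; lra. }
assert (h4 : forall t, al 1%nat t = b / 2 * (D1 * E t) - b / 2 * (D2 * / E t)).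
{ intros t; apply (is_derive_unique_ext _ _ _ _ _ (dal 0%nat t) h2).
  specialize (hE t); pose proof (dE t) as h; auto_derive;
    [repeat split; try (eexists; eassumption); lra |].
  rewrite (Derive_of _ _ _ h); field; lra. }
assert (h5 : forall t, ta 0%nat t - ta 0%nat 0 =
  C1 / b * (E t * E t) - C2 / b * / (E t * E t)
  - (C1 / b * (E 0 * E 0) - C2 / b * / (E 0 * E 0))).
{ intros t; assert (e := same_derive (fun _ => True) (ta 0%nat)
    (fun t => C1 / b * (E t * E t) - C2 / b * / (E t * E t)) (ta 1%nat)); simpl in e.
  apply e; trivial; intros s _; rewrite h1.
  specialize (hE s); pose proof (dE s) as h; auto_derive;
    [repeat split; try (eexists; eassumption); nra |].
  rewrite (Derive_of _ _ _ h); field; lra. }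
(* [si] is the part of lambda that depends on t only, once the formula based at x = y = 1 is
   re-expanded at x = y = 0. *)
set (si := fun t => la 0%nat t - 2 * (ta 2%nat t + b * ta 1%nat t)
  - (2 * al 1%nat t + b * al 0%nat t)).
assert (h6 : forall t, si t - si 0 = - (1 / 4 + d) * (ta 1%nat t + b * ta 0%nat t)
  - - (1 / 4 + d) * (ta 1%nat 0 + b * ta 0%nat 0)).
{ intros t; assert (e := same_derive (fun _ => True) si
    (fun t => - (1 / 4 + d) * (ta 1%nat t + b * ta 0%nat t))
    (fun t => - (1 / 4 + d) * (ta 2%nat t + b * ta 1%nat t))); simpl in e.
  apply e; trivial; intros s _; unfold si; pose proof (dta 0%nat s) as e0;
    pose proof (dta 1%nat s) as e1; pose proof (dta 2%nat s) as e2;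
    pose proof (dal 0%nat s) as e3; pose proof (dal 1%nat s) as e4;
    pose proof (dla 0%nat s) as e5.
  - destruct (two_factor_ode s) as [_ [_ h]].
    auto_derive; [repeat split; eexists; eassumption |].
    rewrite (Derive_of _ _ _ e1), (Derive_of _ _ _ e2), (Derive_of _ _ _ e3),
      (Derive_of _ _ _ e4), (Derive_of _ _ _ e5), h; ring.
  - auto_derive; [repeat split; eexists; eassumption |].
    rewrite (Derive_of _ _ _ e0), (Derive_of _ _ _ e1); ring. }
set (cH := ta 0%nat 0 - C1 / b + C2 / b).
(* Matching with [two_factor_term]: tau' fixes M_E and M_F, the constant cH in tau equals (2/b) M_H,
   and M_Z makes the part of lambda independent of x and y equal to si(0) at t = 0. *)
exists (fun i => match i with
  | M_E => C1 / b | M_F => b * C2 | M_H => b / 2 * cH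
  | M_X => D1 | M_Y => - b * D2
  | M_Z => si 0 + (1 / 4 + d) * (2 * C1 + b * cH) end).
intros x y t hx hy k; destruct (two_factor_y_trivial t) as [e1 e2].
assert (e3 : be 1%nat t = 0).
{ apply (is_derive_unique_ext _ (fun _ => 0) t _ _ (dbe 0%nat t));
    [intros s; apply two_factor_y_trivial | apply @is_derive_const]. }
specialize (h5 t); specialize (h6 t); specialize (hE t).
assert (e4 : la 0%nat t = si t + 2 * (ta 2%nat t + b * ta 1%nat t)
  + (2 * al 1%nat t + b * al 0%nat t)) by (unfold si; ring).
assert (e5 : ta 0%nat t = cH + C1 / b * (E t * E t) - C2 / b * / (E t * E t))
  by (unfold cH; rewrite E0 in h5; replace (C2 / b * / (1 * 1)) with (C2 / b) in h5
      by (field; trivial);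
      lra).
assert (e6 : ta 0%nat 0 = cH + C1 / b - C2 / b) by (unfold cH; ring).
destruct k as [[] |]; simpl; rewrite ?eE.
- rewrite hX, e2, (h1 t), (h2 t) by trivial; real_eq; field; lra.
- rewrite hY, e1, e2, (h1 t) by trivial; real_eq; field; lra.
- rewrite hT, e5 by trivial; real_eq; field; lra.
- rewrite two_factor_lambda, e1, e2, e3, e4 by trivial.
  replace (si t) with (si 0 - (1 / 4 + d) * (ta 1%nat t + b * ta 0%nat t)
    + (1 / 4 + d) * (ta 1%nat 0 + b * ta 0%nat 0)) by lra.
  rewrite e5, e6, (h1 0), E0, (h1 t), (h2 t), (h3 t), (h4 t); real_eq.
  assert (hs := sqrt_lt_R0 _ hy); field; lra.
Qed.
End UCoefficient.

Lemma two_factor_classification b d v : b <> 0 -> d <> 1 / 4 -> d <> 3 / 4 ->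
  lie_car (L_alg (1 / 4) b d b) v -> exists A, two_factor_field b d A = v.
Proof.
intros b0 d1 d3 sv.
destruct (two_factor_structure b d v sv) as [ta [al [be [ka [dta [dal [dbe [dka hv]]]]]]]].
destruct (two_factor_smooth_t (fun z => v z None)) as [la [hla dla]];
  [intros n; apply (two_factor_smooth b d v sv) |].
destruct (two_factor_coefficients b d v sv b0 d1 d3 ta al be ka la dta dal dbe dka dla hv
  (fun t => eq_sym (hla t))) as [A hA].
exists A; apply functional_extensionality; intros z.
apply functional_extensionality; intros k; unfold two_factor_field.
destruct (excluded_middle_informative (quadrant z)) as [hz | hz];
  [| rewrite term_vfield_out by trivial; symmetry; now apply sv].
rewrite term_vfieldE by trivial; destruct hz as [hx hy].
rewrite (pointE z); revert hx hy; generalize (z (Some x_)) (z (Some y_)) (z (Some t_)) (z None).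
intros x y t u hx hy; destruct (two_factor_at_one b d v sv x y t u hx hy) as [e1 [e2 [e3 e4]]].
destruct k as [[] |].
- now rewrite e2, hA.
- now rewrite e3, hA.
- now rewrite e1, <- (proj1 (two_factor_at_one b d v sv x y t 1 hx hy)), hA.
- rewrite e4, hA by trivial; simpl; real_eq; ring.
Qed.

(** * Both symmetry algebras as models of M *)

Lemma term_vfield_linear {J} `{Index J} (D : (J -> R) -> Prop) (F : M_space -> J -> term J) k A B :
  (forall z i, D z -> eval (F (plus (scal k A) B) i) z = k * eval (F A i) z + eval (F B i) z) ->
  term_vfield D (F (plus (scal k A) B)) =
  plus (scal k (term_vfield D (F A))) (term_vfield D (F B)).
Proof.
intros h; apply functional_extensionality; intros z; apply functional_extensionality; intros i.
change (term_vfield D (F (plus (scal k A) B)) z i =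
  k * term_vfield D (F A) z i + term_vfield D (F B) z i).
destruct (excluded_middle_informative (D z)) as [hz | hz].
- now rewrite !term_vfieldE, h.
- rewrite !term_vfield_out by trivial; real_eq; ring.
Qed.

Lemma heat_model : lie_model M_alg H00_alg heat_field.
Proof.
split.
- intros k A B _ _; apply term_vfield_linear; intros z i _.
  destruct i as [[] |]; cbn; field.
- intros A B _ _ e.
  assert (h : forall t q i, eval (heat_term A i) (point_tq t q 1)
    = eval (heat_term B i) (point_tq t q 1)).
  { intros t q i; rewrite <- !(term_vfieldE (fun _ => True)) by trivial.
    exact (f_equal (fun w => w (point_tq t q 1) i) e). }
  pose proof (h 0 0 (Some th_)); pose proof (h 1 0 (Some th_)); pose proof (h (-1) 0 (Some th_)).
  pose proof (h 0 0 (Some qh_)); pose proof (h 1 0 (Some qh_)); pose proof (h 0 0 None).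
  simpl in *; apply functional_extensionality; intros []; lra.
- intros w; split; [intros hw | intros [A [_ <-]]; apply heat_field_symmetry].
  destruct (heat_classification w hw) as [A hA]; now exists A.
- intros A B _ _; apply heat_field_bracket.
Qed.

Lemma two_factor_model b d : b <> 0 -> d <> 1 / 4 -> d <> 3 / 4 ->
  lie_model M_alg (L_alg (1 / 4) b d b) (two_factor_field b d).
Proof.
intros b0 d1 d3; split.
- intros k A B _ _; apply term_vfield_linear; intros z i [hx hy].
  assert (hE := exp_pos (b / 2 * z (Some t_))).
  destruct i as [[] |]; cbn; field; repeat split; trivial; lra.
- intros A B _ _ e.
  (* At the time (2/b) ln E the quantity exp(bt/2) equals E. The values E = 1, 2, 3 separate the
     terms E^2, E^(-2), 1 of tau, two of them separate E and 1/E in xi, and one value of lambda then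
     gives M_Z. *)
  assert (h : forall E i, 0 < E -> eval (two_factor_term b d A i) (point 1 1 (2 / b * ln E) 1)
    = eval (two_factor_term b d B i) (point 1 1 (2 / b * ln E) 1)).
  { intros E i hE; rewrite <- !(term_vfieldE quadrant) by (split; apply Rlt_0_1).
    exact (f_equal (fun w => w (point 1 1 (2 / b * ln E) 1) i) e). }
  assert (hexp : forall E, 0 < E -> exp (b / 2 * (2 / b * ln E)) = E).
  { intros E hE; rewrite <- (exp_ln E) at 2 by trivial; f_equal; field; trivial. }
  pose proof (fun i => h 1 i ltac:(lra)) as h1; pose proof (fun i => h 2 i ltac:(lra)) as h2.
  pose proof (fun i => h 3 i ltac:(lra)) as h3.
  pose proof (h1 (Some t_)) as t1; pose proof (h2 (Some t_)) as t2; pose proof (h3 (Some t_)) as t3.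
  pose proof (h1 (Some x_)) as x1; pose proof (h2 (Some x_)) as x2; pose proof (h1 None) as u1.
  clear h h1 h2 h3 e; simpl in *; rewrite !hexp, ?sqrt_1 in * by lra; clear hexp.
  replace (/ (1 * 1)) with 1 in * by field; replace (/ (2 * 2)) with (1 / 4) in * by field.
  replace (/ (3 * 3)) with (1 / 9) in * by field; replace (/ 1) with 1 in * by field.
  assert (i0 : / b <> 0) by now apply Rinv_neq_0_compat.
  assert (eE : A M_E = B M_E) by lra.
  assert (eF : A M_F = B M_F).
  { apply (Rmult_eq_reg_r (/ (b * b)));
      [unfold Rdiv in *; lra | apply Rinv_neq_0_compat; now apply Rmult_integral_contrapositive]. }
  assert (eH : A M_H = B M_H) by (apply (Rmult_eq_reg_r (/ b)); unfold Rdiv in *; lra).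
  rewrite eE, eF, eH in *.
  assert (eX : A M_X = B M_X) by (unfold Rdiv in *; lra).
  assert (eY : A M_Y = B M_Y) by (apply (Rmult_eq_reg_r (/ b)); unfold Rdiv in *; lra).
  rewrite eX, eY in *.
  assert (eZ : A M_Z = B M_Z) by lra.
  now apply functional_extensionality; intros [].
- intros w; split; [intros hw | intros [A [_ <-]]; now apply two_factor_field_symmetry].
  destruct (two_factor_classification b d w) as [A hA]; trivial; now exists A.
- intros A B _ _; now apply two_factor_field_bracket.
Qed.

Theorem mainTheorem10 (a b d e : R)
  (ha : a = 1 / 4) (hd : d <> 1 / 4) (hd' : d <> 3 / 4)
  (hbe : b = e) (hb : b <> 0) :
  is_lie_algebra (L_alg a b d e) /\
  has_dimension (L_alg a b d e) 6 /\
  is_basis (L_alg a b d e) [v1 b d; v2 b; v3 b d; v4 b; v5 b; v6] /\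
  (exists f : L_alg a b d e -> M_alg,
    is_linear_map (L_alg a b d e) M_alg f /\
    f (v1 b d) = M_vec M_E /\
    f (v2 b) = scal (- b ^ 2) (M_vec M_F) /\
    f (v3 b d) = scal (b / 2) (M_vec M_H) /\
    f (v4 b) = M_vec M_X /\
    f (v5 b) = scal (- b) (M_vec M_Y) /\
    f v6 = M_vec M_Z /\
    is_lie_morphism (L_alg a b d e) M_alg f) /\
  lie_isomorphic (L_alg a b d e) M_alg /\
  lie_isomorphic (L_alg a b d e) H00_alg.
Proof.
subst a e.
assert (m := two_factor_model b d hb hd hd').
(* Both sides are extensions by zero from the quadrant, so comparing the four formulas there
   identifies the fields. *)
assert (hF : forall A xi ga ta phi,
  (forall x y t u, 0 < x -> 0 < y ->
    eval (two_factor_term b d A (Some x_)) (point x y t u) = xi x y t u /\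
    eval (two_factor_term b d A (Some y_)) (point x y t u) = ga x y t u /\
    eval (two_factor_term b d A (Some t_)) (point x y t u) = ta x y t u /\
    eval (two_factor_term b d A None) (point x y t u) = phi x y t u) ->
  vf_xytu xi ga ta phi = two_factor_field b d A).
{ intros A xi ga ta phi h; apply functional_extensionality; intros z.
  apply functional_extensionality; intros k; unfold vf_xytu, two_factor_field, term_vfield, ext0.
  destruct (excluded_middle_informative (quadrant z)) as [[hx hy] |]; trivial.
  destruct (h _ _ (z (Some t_)) (z None) hx hy) as [h1 [h2 [h3 h4]]].
  rewrite <- pointE in *; destruct k as [[] |]; now symmetry. }
assert (hE : forall t, exp (b / 2 * t) <> 0) by (intros; apply Rgt_not_eq, exp_pos).
assert (e1 : forall t, exp (b * t) = exp (b / 2 * t) * exp (b / 2 * t))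
  by (intros t; rewrite <- exp_plus; f_equal; field).
assert (e2 : forall t, exp (- b * t) = / (exp (b / 2 * t) * exp (b / 2 * t)))
  by (intros t; rewrite <- e1, <- exp_Ropp; f_equal; ring).
assert (e3 : forall t, exp (- b / 2 * t) = / exp (b / 2 * t))
  by (intros t; rewrite <- exp_Ropp; f_equal; field).
assert (E1 : v1 b d = two_factor_field b d (M_vec M_E))
  by (apply hF; intros x y t u hx hy; cbn; rewrite ?e1; repeat split; field; auto).
assert (E2 : v2 b = two_factor_field b d (scal (- b ^ 2) (M_vec M_F)))
  by (apply hF; intros x y t u hx hy; cbn; unfold mult; simpl; rewrite ?e2;
      repeat split; field; auto).
assert (E3 : v3 b d = two_factor_field b d (scal (b / 2) (M_vec M_H)))
  by (apply hF; intros x y t u hx hy; cbn; unfold mult; simpl;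
      repeat split; field; auto).
assert (E4 : v4 b = two_factor_field b d (M_vec M_X))
  by (apply hF; intros x y t u hx hy; cbn; repeat split; field; auto).
assert (E5 : v5 b = two_factor_field b d (scal (- b) (M_vec M_Y)))
  by (apply hF; intros x y t u hx hy; cbn; unfold mult; simpl; rewrite ?e3;
      repeat split; field; auto).
assert (E6 : v6 = two_factor_field b d (M_vec M_Z))
  by (apply hF; intros x y t u hx hy; cbn; repeat split; field; auto).
assert (B : is_basis (L_alg (1 / 4) b d b) [v1 b d; v2 b; v3 b d; v4 b; v5 b; v6]).
{ rewrite E1, E2, E3, E4, E5, E6.
  apply (model_basis m M_lie_algebra [M_vec M_E; scal (- b ^ 2) (M_vec M_F);
    scal (b / 2) (M_vec M_H); M_vec M_X; scal (- b) (M_vec M_Y); M_vec M_Z]).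
  apply M_basis; [| lra | lra].
  apply Ropp_neq_0_compat, pow_nonzero, hb. }
assert (iM := model_isomorphic m M_lie_algebra).
assert (f := model_inv_morphism m M_lie_algebra).
split; [exact (model_lie_algebra m M_lie_algebra) |].
split; [eexists; split; [exact B | reflexivity] |].
split; [exact B |].
split; [| split; [exact iM | exact (lie_isomorphic_model _ _ _ _ iM heat_model)]].
(* The required map is the inverse of the parametrization, so its values at v_1, ..., v_6 are their
   parameters. *)
exists (@model_inv M_alg (L_alg (1 / 4) b d b) (two_factor_field b d)).
rewrite E1, E2, E3, E4, E5, E6.
repeat split; try (apply (model_invK m); exact I); apply f.
Qed.
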